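(* Let $M$ be an oriented smooth surface embedded in a Weitzenböck $3$-manifold $\tilde M$. Let $g\colon M\to\mathbb{S}^2$ be the Gauss map. Then, under the identification $\phi\colon TM\to g^*T\mathbb{S}^2$, $$-\phi^{-1}\Delta g=\operatorname{grad}H+J\operatorname{grad}{\star}\tau+(HI+({\star}\tau)J-W)(\operatorname{tr}T)^\sharp,$$ $$-\phi^{-1}\bar\Delta g=\operatorname{grad}H+J\operatorname{grad}{\star}\tau+(HI+({\star}\tau)J)(\operatorname{tr}T)^\sharp,$$ where $H$ is the mean curvature, $\tau$ is the normal component of the ambient torsion, $I$ is the identity operator, $J$ is the almost complex structure on $M$, $W$ is the Weingarten map, and $\operatorname{tr}T$ is the contraction of the torsion of $M$. In particular, if $H+i\,{\star}\tau=0$ everywhere, then the Gauss map is harmonic with respect to the Levi-Civita connection on $M$ (that is, $\bar\Delta g=0$).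
   Context: A Riemann-Cartan manifold is a Riemannian manifold endowed with a metric-compatible connection $\nabla$, possibly with torsion $T(X,Y)=\nabla_XY-\nabla_YX-[X,Y]$. A Weitzenböck $3$-manifold $\tilde M$ is a smooth $3$-manifold with a fixed global smooth frame $(\tilde E_1,\tilde E_2,\tilde E_3)$, equipped with the orientation and the metric making this frame oriented orthonormal, and with the metric-compatible flat connection $\tilde\nabla$ determined by $\tilde\nabla\tilde E_i=0$; $\tilde T$ is its torsion. An oriented smooth surface $M\subset\tilde M$ carries the restricted metric $\langle\cdot,\cdot\rangle$ and the projected connection $\nabla_XY=(\tilde\nabla_XY)^\top$ (tangential part), with torsion $T$; $\bar\nabla$ denotes the Levi-Civita connection of the induced metric on $M$. $N$ is the unit normal field along $M$ such that a frame $(E_1,E_2)$ of $M$ is oriented iff $(N,E_1,E_2)$ is oriented in $\tilde M$. The Weingarten map $W$ is the $(1,1)$-tensor field with $\langle WX,Y\rangle=\langle N,\tilde\nabla_XY\rangle$; $H=\operatorname{tr}W$. $\tau\in\Omega^2(M,\mathbb{R})$ is $\tau(X,Y)=\langle N,\tilde T(X,Y)\rangle$, and ${\star}\tau$ is its Hodge dual function (so ${\star}\tau=\tau(E_1,E_2)$ for an oriented orthonormal frame). $J$ is rotation by $+90^\circ$ ($JE_1=E_2$, $JE_2=-E_1$). $\operatorname{tr}T\in\Omega^1(M,\mathbb{R})$ is $(\operatorname{tr}T)(X)=\operatorname{tr}(T(X,\cdot))$; $\sharp$ is the metric dual; $\operatorname{grad}f=(\mathrm{d}f)^\sharp$. Gauss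 map: writing $N=\sum_iN^i\tilde E_i$, $g=(N^1,N^2,N^3)\colon M\to\mathbb{S}^2$. Identification: for $p\in M$ the linear isometry $\phi\colon T_p\tilde M\to\mathbb{R}^3$ sending a vector to its coefficient vector relative to $(\tilde E_i|_p)$ sends $N|_p$ to $g(p)$ and restricts to an isometry $T_pM\to T_{g(p)}\mathbb{S}^2$; this gives a vector bundle isomorphism $\phi\colon TM\to g^*T\mathbb{S}^2$. Laplacians: $\Delta g=\sum_i\big[(g^*\nabla^{\mathbb{S}^2})_{E_i}(\mathrm{d}g(E_i))-\mathrm{d}g(\nabla_{E_i}E_i)\big]$ for a local orthonormal frame $(E_i)$ of $M$, where $\nabla^{\mathbb{S}^2}$ is the Levi-Civita connection of the round metric; $\bar\Delta g$ is the same expression with $\bar\nabla$ in place of $\nabla$. *)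

(* Defs.v *)
From HB Require Import structures.
From mathcomp Require Import all_boot all_order all_algebra.
From mathcomp Require Import all_classical all_reals all_analysis.
From mathcomp Require Import complex.
Set Implicit Arguments.
Unset Strict Implicit.
Unset Printing Implicit Defensive.
Import Order.TTheory GRing.Theory Num.Theory.
Import numFieldNormedType.Exports.
Local Open Scope classical_set_scope.
Local Open Scope ring_scope.

Section Smooth.
Variables (R : realType) (V W : normedModType R).

Fixpoint Ck (k : nat) (f : V -> W) (U : set V) : Prop :=
  match k with
  | 0 => forall x, U x -> {for x, continuous f}
  | k'.+1 => (forall x, U x -> differentiable f x) /\
             (forall v, Ck k' (fun x => 'D_v f x) U)
  end.

(* C^oo on U; only meaningful for U open *)
Definition Coo (f : V -> W) (U : set V) : Prop := forall k, Ck k f U.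

End Smooth.

(* [cmap] and [cinv] are total functions; only their values on [cdom] and on
   [cmap @` cdom] matter. *)
Record chart (R : realType) (n : nat) (T : topologicalType) := Chart {
  cdom : set T;
  cmap : T -> 'rV[R]_n;
  cinv : 'rV[R]_n -> T;
  cdom_open : open cdom;
  cim_open : open (cmap @` cdom);
  cmapK : forall p, cdom p -> cinv (cmap p) = p;
  cmap_continuous : forall p, cdom p -> {for p, continuous cmap};
  cinv_continuous : forall u, (cmap @` cdom) u -> {for u, continuous cinv}
}.

Record manifold (R : realType) (n : nat) := Manifold {
  mtype :> topologicalType;
  m_hausdorff : hausdorff_space mtype;
  m_second_countable : @second_countable mtype;
  atlas : set (chart R n mtype);
  atlas_cover : forall p, exists2 c, atlas c & cdom c p;
  atlas_compat : forall c c', atlas c -> atlas c' ->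
    Coo (cmap c' \o cinv c) (cmap c @` (cdom c `&` cdom c'))
}.

Section Tangent.
Variables (R : realType) (n : nat) (M : manifold R n).

(* f : M -> R is C^oo on some neighbourhood of p (its values far from p are
   arbitrary, so f stands for a germ at p) *)
Definition smooth_at (p : M) (f : M -> R) : Prop :=
  exists c, [/\ atlas c, cdom c p &
    exists2 U, open_nbhs (cmap c p) U & Coo (f \o cinv c) U].

(* Tangent vectors act on functions as directional derivatives.  The value on
   functions that are not smooth near the base point carries no information and
   is normalized to 0, so that equality of tangent vectors is plain equality of
   operators and the linear structure is the pointwise one. *)
Definition tvec : Type := (M -> R) -> R.

Definition germ (p : M) (v : tvec) : tvec :=
  fun f => if `[< smooth_at p f >] then v f else 0.

Definition is_tangent (p : M) (v : tvec) : Prop :=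
  exists c a, [/\ atlas c, cdom c p &
    v = germ p (fun f => 'D_a (f \o cinv c) (cmap c p))].

Definition is_basis (p : M) (e : 'I_n -> tvec) : Prop :=
  (forall i, is_tangent p (e i)) /\
  (forall v, is_tangent p v ->
     exists! a : 'rV[R]_n, v = \sum_i a 0 i *: e i).

(* Here and below, xget selects the unique element of a set given by the
   characterization of the object being defined. *)
Definition coord (e : 'I_n -> tvec) (v : tvec) : 'rV[R]_n :=
  xget 0 [set a : 'rV[R]_n | v = \sum_i a 0 i *: e i].

(* trace of an endomorphism A of T_pM *)
Definition trace (p : M) (A : tvec -> tvec) : R :=
  xget 0 [set t | exists2 e, is_basis p e &
                  t = \sum_i coord e (A (e i)) 0 i].

Definition smooth_field (X : M -> tvec) (p : M) : Prop :=
  \forall q \near p, is_tangent q (X q) /\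
    forall f, smooth_at q f -> smooth_at q (fun r => X r f).

(* an orientation of M, as the predicate "e is an oriented frame of T_pM" *)
Definition is_orientation (pos : M -> ('I_n -> tvec) -> Prop) : Prop :=
  [/\ forall p e, pos p e -> is_basis p e,
      forall p e (a : 'M[R]_n), pos p e ->
        pos p (fun i => \sum_j a i j *: e j) <-> 0 < \det a &
      forall p : M, exists X : 'I_n -> M -> tvec,
        (forall i, smooth_field (X i) p) /\
        (\forall q \near p, pos q (fun i => X i q))].

Definition bracket (X Y : M -> tvec) (p : M) : tvec :=
  germ p (fun f => X p (fun q => Y q f) - Y p (fun q => X q f)).

End Tangent.

Section Maps.
Variables (R : realType) (m n : nat) (P : manifold R m) (Q : manifold R n).
Implicit Type h : P -> Q.

Definition smooth_map h : Prop := continuous h /\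
  forall p f, smooth_at (h p) f -> smooth_at p (f \o h).

Definition dmap h (p : P) (v : tvec P) : tvec Q :=
  germ (h p) (fun f => v (f \o h)).

(* injective immersion that is a homeomorphism onto its image *)
Definition embedding h : Prop :=
  [/\ smooth_map h, injective h,
      forall p v, is_tangent p v -> dmap h p v = 0 -> v = 0 &
      forall U : set P, open U -> exists2 V : set Q, open V & U = h @^-1` V].

(* V is, near p, a smooth section of h^*TQ *)
Definition smooth_along h (V : P -> tvec Q) (p : P) : Prop :=
  \forall q \near p, is_tangent (h q) (V q) /\
    forall f, smooth_at (h q) f -> smooth_at q (fun r => V r f).

(* D is a connection on h^*TQ; D p x V is the derivative of V along x at p.
   The sections V need only be smooth near p; taking f to be the indicator
   function of a neighbourhood of p in the Leibniz rule shows that D p x V only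
   depends on the germ of V at p. *)
Definition connection_along h (D : P -> tvec P -> (P -> tvec Q) -> tvec Q)
    : Prop :=
  [/\ forall p x V, is_tangent p x -> smooth_along h V p ->
        is_tangent (h p) (D p x V),
      forall p (a : R) x y V, is_tangent p x -> is_tangent p y ->
        smooth_along h V p ->
        D p (a *: x + y) V = a *: D p x V + D p y V,
      forall p x V V', is_tangent p x -> smooth_along h V p ->
        smooth_along h V' p ->
        D p x (fun q => V q + V' q) = D p x V + D p x V',
      forall p x f V, is_tangent p x -> smooth_at p f -> smooth_along h V p ->
        D p x (fun q => f q *: V q) = x f *: V p + f p *: D p x V &
      forall p X V, smooth_field X p -> smooth_along h V p ->
        smooth_along h (fun q => D q (X q) V) p].

(* D is the pull-back along h of the connection nabla of Q *)
Definition is_pullback (nabla : Q -> tvec Q -> (Q -> tvec Q) -> tvec Q) h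
    (D : P -> tvec P -> (P -> tvec Q) -> tvec Q) : Prop :=
  connection_along h D /\
  forall p x Y, is_tangent p x -> smooth_field Y (h p) ->
    D p x (Y \o h) = nabla (h p) (dmap h p x) Y.

End Maps.

Section Connections.
Variables (R : realType) (n : nat) (M : manifold R n).

Definition connection := M -> tvec M -> (M -> tvec M) -> tvec M.
Implicit Type nabla : connection.

Definition is_connection nabla : Prop :=
  connection_along (P := M) (Q := M) id nabla.

Definition torsion_field nabla (X Y : M -> tvec M) (p : M) : tvec M :=
  nabla p (X p) Y - nabla p (Y p) X - bracket X Y p.

(* T_p(x,y) = T(X,Y)_p for any extensions X, Y of x, y to local fields *)
Definition torsion nabla (p : M) (x y : tvec M) : tvec M :=
  xget 0 [set t | exists X Y,
    [/\ smooth_field X p, smooth_field Y p, X p = x, Y p = y &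
        t = torsion_field nabla X Y p]].

Definition is_levi_civita (gm : M -> tvec M -> tvec M -> R) nabla : Prop :=
  [/\ is_connection nabla,
      forall p X Y, smooth_field X p -> smooth_field Y p ->
        torsion_field nabla X Y p = 0 &
      forall p x Y Z, is_tangent p x -> smooth_field Y p -> smooth_field Z p ->
        x (fun q => gm q (Y q) (Z q)) =
        gm p (nabla p x Y) (Z p) + gm p (Y p) (nabla p x Z)].

End Connections.

(* The connection is determined by wconn_frame; that it is flat and compatible
   with the metric below follows. *)
Record weitzenbock (R : realType) := Weitzenbock {
  wman :> manifold R 3;
  wframe : 'I_3 -> wman -> tvec wman;
  wframe_smooth : forall i p, smooth_field (wframe i) p;
  wframe_basis : forall p, is_basis p (fun i => wframe i p);
  wconn : connection wman;
  wconn_connection : is_connection wconn;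
  wconn_frame : forall i p x, is_tangent p x -> wconn p x (wframe i) = 0
}.

Section Ambient.
Variables (R : realType) (Mt : weitzenbock R).

(* coefficient vector relative to the frame *)
Definition wcoord (p : Mt) (v : tvec Mt) : 'rV[R]_3 :=
  coord (fun i => wframe (w := Mt) i p) v.

Definition wmetric (p : Mt) (v w : tvec Mt) : R :=
  \sum_i wcoord p v 0 i * wcoord p w 0 i.

Definition woriented (p : Mt) (e : 'I_3 -> tvec Mt) : Prop :=
  (forall i, is_tangent p (e i)) /\
  0 < \det (\matrix_(i, j) wcoord p (e i) 0 j).

End Ambient.

Record oriented_surface (R : realType) (Mt : weitzenbock R) := OrientedSurface {
  sman :> manifold R 2;
  sincl : sman -> Mt;
  sincl_embedding : embedding sincl;
  spos : sman -> ('I_2 -> tvec sman) -> Prop;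
  spos_orientation : is_orientation spos
}.

(* The unit sphere of R^3 as an embedded submanifold; this determines the smooth
   structure up to a diffeomorphism compatible with upt. *)
Record unit_sphere (R : realType) := UnitSphere {
  uman :> manifold R 2;
  upt : uman -> 'rV[R]_3;
  upt_smooth : forall i q, smooth_at q (fun r => upt r 0 i);
  upt_inj : injective upt;
  upt_immersion : forall q v, is_tangent q v ->
    (forall i, v (fun r => upt r 0 i) = 0) -> v = 0;
  upt_homeo : continuous upt /\
    forall U : set uman, open U -> exists2 V, open V & U = upt @^-1` V;
  upt_range : range upt = [set y | \sum_i y 0 i ^+ 2 = 1]
}.

Section SphereMetric.
Variables (R : realType) (S2 : unit_sphere R).

(* the coefficients in R^3 of a tangent vector of the sphere *)
Definition ucoord (v : tvec S2) : 'rV[R]_3 :=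
  \row_i v (fun r => upt r 0 i).

Definition round_metric (q : S2) (v w : tvec S2) : R :=
  \sum_i ucoord v 0 i * ucoord w 0 i.

End SphereMetric.

Section Surface.
Variables (R : realType) (Mt : weitzenbock R) (M : oriented_surface Mt).

Definition dincl (p : M) (x : tvec M) : tvec Mt := dmap (sincl (o := M)) p x.

Definition smetric (p : M) (x y : tvec M) : R :=
  wmetric (sincl p) (dincl p x) (dincl p y).

Definition orthonormal (p : M) (e : 'I_2 -> tvec M) : Prop :=
  (forall i, is_tangent p (e i)) /\
  (forall i j, smetric p (e i) (e j) = (i == j)%:R).

Definition local_orthonormal_frame (p : M) (E : 'I_2 -> M -> tvec M) : Prop :=
  (forall i, smooth_field (E i) p) /\
  \forall q \near p, orthonormal q (fun i => E i q).

Definition is_unit_normal (N : M -> tvec Mt) : Prop :=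
  [/\ forall p, smooth_along (sincl (o := M)) N p,
      forall p, wmetric (sincl p) (N p) (N p) = 1,
      forall p x, is_tangent p x -> wmetric (sincl p) (N p) (dincl p x) = 0 &
      forall p (e : 'I_2 -> tvec M), (forall i, is_tangent p (e i)) ->
        spos p e <->
        woriented (sincl p)
          (fun k => [:: N p; dincl p (e 0); dincl p (e 1)]`_k)].

Definition tangential (p : M) (z : tvec Mt) : tvec M :=
  xget 0 [set v | is_tangent p v /\ forall w, is_tangent p w ->
    wmetric (sincl p) (z - dincl p v) (dincl p w) = 0].

(* J E_1 = E_2 and J E_2 = - E_1 for oriented orthonormal (E_1, E_2) *)
Definition Jrot (p : M) (x : tvec M) : tvec M :=
  xget 0 [set y | exists e : 'I_2 -> tvec M, [/\ spos p e, orthonormal p e &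
    y = smetric p x (e 0) *: e 1 - smetric p x (e 1) *: e 0]].

Definition sharp (p : M) (alpha : tvec M -> R) : tvec M :=
  xget 0 [set v | is_tangent p v /\ forall w, is_tangent p w ->
    smetric p v w = alpha w].

Definition grad (f : M -> R) (p : M) : tvec M := sharp p (fun x => x f).

(* D is the pull-back to M of the ambient connection *)
Variables (D : M -> tvec M -> (M -> tvec Mt) -> tvec Mt) (N : M -> tvec Mt).

Definition projected_conn : connection M :=
  fun p x Y => tangential p (D p x (fun q => dincl q (Y q))).

Definition weingarten (p : M) (x : tvec M) : tvec M :=
  xget 0 [set w | is_tangent p w /\ forall Y, smooth_field Y p ->
    smetric p w (Y p) =
    wmetric (sincl p) (N p) (D p x (fun q => dincl q (Y q)))].

Definition mean_curv (p : M) : R := trace p (weingarten p).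

Definition tau (p : M) (x y : tvec M) : R :=
  wmetric (sincl p) (N p)
    (torsion (wconn (w := Mt)) (sincl p) (dincl p x) (dincl p y)).

Definition star_tau (p : M) : R :=
  xget 0 [set t | exists e : 'I_2 -> tvec M,
    [/\ spos p e, orthonormal p e & t = tau p (e 0) (e 1)]].

Definition tr_torsion (p : M) (x : tvec M) : R :=
  trace p (torsion projected_conn p x).

End Surface.

Section GaussMap.
Variables (R : realType) (Mt : weitzenbock R) (M : oriented_surface Mt).
Variables (S2 : unit_sphere R).

Definition is_gauss_map (N : M -> tvec Mt) (g : M -> S2) : Prop :=
  forall p, upt (g p) = wcoord (sincl p) (N p).

Variable g : M -> S2.

(* the identification T_pM -> T_{g(p)}S^2 through coefficient vectors in R^3 *)
Definition phi (p : M) (x : tvec M) : tvec S2 :=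
  xget 0 [set w | is_tangent (g p) w /\
                  ucoord w = wcoord (sincl p) (dincl p x)].

Definition phi_inv (p : M) (w : tvec S2) : tvec M :=
  xget 0 [set x | is_tangent p x /\ phi p x = w].

(* DS is the pull-back along g of a connection of S^2, nabla a connection of M,
   E a local orthonormal frame of M at p *)
Definition laplacian (DS : M -> tvec M -> (M -> tvec S2) -> tvec S2)
    (nabla : connection M) (E : 'I_2 -> M -> tvec M) (p : M) : tvec S2 :=
  \sum_i (DS p (E i p) (fun q => dmap g q (E i q))
          - dmap g p (nabla p (E i p) (E i))).

End GaussMap.

(* Main.v *)
Require Import Defs.
From HB Require Import structures.
From mathcomp Require Import all_boot all_order all_algebra.
From mathcomp Require Import all_classical all_reals all_analysis.
From mathcomp Require Import complex ring lra.
Import Order.TTheory GRing.Theory Num.Theory.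
Import numFieldNormedType.Exports.
Local Open Scope classical_set_scope.
Local Open Scope ring_scope.
Set Implicit Arguments.
Unset Strict Implicit.
Unset Printing Implicit Defensive.

(** Everything is read off in coefficient vectors.  For a tangent vector X of the
    surface let s(X) in R^3 be its coefficients relative to the parallel frame
    ([scoord]), and let n be those of the normal field ([ncoord]), so that n is
    the Gauss map followed by the inclusion of the sphere in R^3 and s is the
    identification phi.  As the frame is parallel, the pulled-back ambient
    connection is plain differentiation of coefficient vectors
    ([wcoord_pullback]).  Hence s(W X) = - X(n) ([weingarten_comp]), and the
    torsion of two fields X, Y is X(s(Y)) - Y(s(X)) - s([X, Y])
    ([structure_coord]): its normal component is the antisymmetric part of W,
    its tangential component is the torsion of the projected connection.

    On the sphere the Levi-Civita connection is differentiation in R^3 followed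
    by the tangential projection ([sphere_lc_fields]), also along the Gauss map
    ([sphere_pullback]).  For an orthonormal frame (E_1, E_2) of the surface the
    negative Laplacian is therefore the tangential part of
    - sum_i (E_i E_i n - (nabla_{E_i} E_i) n), the divergence of W.

    Mixed second derivatives of n satisfy
    E_1 E_2 n - E_2 E_1 n = [E_1, E_2] n, which, after the bracket is expressed
    by the connection coefficients and the torsion, is the Codazzi equation
    ([codazzi]).  It exchanges div W for grad tr W plus J grad of the
    antisymmetric part of W, up to terms in the torsion; in dimension two these
    are determined by tr T, and they are (H I + star tau J - W) (tr T)^sharp.
    Finally the sum over i of nabla_{E_i} E_i for the Levi-Civita connection
    differs from that for the projected one by (tr T)^sharp
    ([levi_civita_trace]), which accounts for the term W (tr T)^sharp that the
    second formula lacks.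

    Two points are less formal.  First, a Gauss map is only given by its
    coordinates in R^3, and its smoothness as a map into the sphere is derived
    from the fact that a continuous lift of a smooth map through an immersion
    is smooth ([Ck_lift], [immersion_lift]); continuity of the lift replaces the
    inverse function theorem.  Second, that brackets of fields on the surface
    are tangent follows from the existence of its torsion-free connection
    ([bracket_tangent]), so the symmetry of second derivatives is never
    invoked; brackets of the ambient frame only enter through combinations that
    are tangent for this reason. *)

(** * Differentials of maps between normed spaces *)

Section Diff.
Variable R : realType.
Implicit Types V W : normedModType R.

(** The epsilon form of differentiability, convenient because the estimate in
    [differentiable_lift] mixes two error terms of different nature. *)
Lemma differentiable_eps V W (f : V -> W) x (L : {linear V -> W}) :
  continuous L ->
  (forall e, 0 < e -> \forall h \near 0, `|f (h + x) - f x - L h| <= e * `|h|) ->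
  differentiable f x /\ 'd f x = L :> (V -> W).
Proof.
move=> cL H.
have E : f \o shift x = cst (f x) + L +o_ 0 id.
  apply/eqaddoP => e e0; have := H e e0.
  apply: filterS => h /=.
  rewrite /cst !fctE /= opprD addrA.
  done.
have dL := diff_unique cL E.
by split => //; apply/diff_locallyP; rewrite dL.
Qed.

Lemma diff_eps V W (f : V -> W) x e : 0 < e -> differentiable f x ->
  \forall h \near 0, `|f (h + x) - f x - 'd f x h| <= e * `|h|.
Proof.
move=> e0 /diff_locally /eqaddoP /(_ e e0); apply: filterS => h /=.
by rewrite /cst !fctE /= opprD addrA.
Qed.

Lemma near_differentiable V W (f g : V -> W) x :
  {near x, f =1 g} -> differentiable f x -> differentiable g x.
Proof.
move=> fg df; have [//|] := @differentiable_eps V W g x ('d f x) (diff_continuous df) _.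
move=> e e0; have H := diff_eps e0 df.
have fg0 : \forall h \near 0, f (h + x) = g (h + x).
  by move: fg; rewrite (near_shift 0) /=; apply: filterS => h /=; rewrite subr0.
near=> h; rewrite -(near fg0 h) // -(nbhs_singleton fg).
by near: h.
Unshelve. all: by end_near. Qed.

Lemma differentiable_rV V n (f : V -> 'rV[R]_n) x :
  (forall i, differentiable (fun y => f y 0 i) x) -> differentiable f x.
Proof.
move=> df.
rewrite (_ : f = \sum_(i < n) (fun y => f y 0 i *: delta_mx 0 i)).
  by apply: differentiable_sum => i; apply: differentiableZl.
apply/funext => y; rewrite fct_sumE; exact: row_sum_delta.
Qed.

Lemma differentiable_rVi V n (f : V -> 'rV[R]_n) x i :
  differentiable f x -> differentiable (fun y => f y 0 i) x.
Proof.
move=> df; apply: (@differentiable_comp _ _ _ _ f (fun N : 'rV[R]_n => N 0 i)) => //.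
exact: differentiable_coord.
Qed.

Lemma derive_rVi V n (f : V -> 'rV[R]_n) x v i :
  differentiable f x -> ('D_v f x) 0 i = 'D_v (fun y => f y 0 i) x.
Proof.
by move=> df; rewrite derive_mx ?mxE//; apply: diff_derivable.
Qed.

Lemma derive_comp_rV V n (u : V -> 'rV[R]_n) (f : 'rV[R]_n -> R) x v :
  differentiable u x -> differentiable f (u x) ->
  'D_v (f \o u) x = \sum_i 'D_v (fun y => u y 0 i) x * 'D_(delta_mx 0 i) f (u x).
Proof.
move=> du df; rewrite deriveE; last exact: differentiable_comp.
rewrite diff_comp // [LHS]/= -(deriveE v du) [X in 'd f _ X]row_sum_delta linear_sum.
apply: eq_bigr => i _; rewrite linearZ /= derive_rVi //; congr (_ * _).
by rewrite deriveE.
Qed.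

(** Write k for the increment of u.  The two first-order expansions say that
    k - d(P o u) h is the difference of an o(h) and an o(k); the latter is at
    most |k|/2, which bounds |k| by a multiple of |h| and so turns the o(k) into
    an o(h). *)
Lemma differentiable_lift V W (u : V -> W) (P : W -> W) x :
  {for x, continuous u} -> differentiable P (u x) ->
  'd P (u x) = id :> (W -> W) -> differentiable (P \o u) x ->
  differentiable u x.
Proof.
move=> cu dP dPid dg; set g := P \o u in dg.
have [K K0 HK] := linear_lipschitz (diff_continuous dg).
have [//|] := @differentiable_eps V W u x ('d g x) (diff_continuous dg) _.
move=> e e0.
pose e1 := e / 2; have e10 : 0 < e1 by rewrite divr_gt0.
have Ke1 : 0 < K + e1 by rewrite addr_gt0.
(* 1/2 absorbs the term in |k|; the other bound turns e2 |k| into e1 |h| *)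
pose e2 := Num.min (1 / 2) (e / (4 * (K + e1))).
have e20 : 0 < e2 by rewrite lt_min !divr_gt0 ?mulr_gt0.
have H1 := diff_eps e10 dg.
have H2 := diff_eps e20 dP.
have cu0 : (fun h => u (h + x) - u x) @ 0 --> 0.
  rewrite -(subrr (u x)); apply: cvgB; last exact: cvg_cst.
  by rewrite -[h in h @ _]/(u \o shift x) cvg_comp_shift add0r.
have H3 : \forall h \near 0, let k := u (h + x) - u x in
    `|P (k + u x) - P (u x) - 'd P (u x) k| <= e2 * `|k| by exact: cu0 _ H2.
near=> h.
have H3h : let k := u (h + x) - u x in
    `|P (k + u x) - P (u x) - 'd P (u x) k| <= e2 * `|k| by near: h; exact: H3.
pose k := u (h + x) - u x.
have hk : `|k - 'd g x h| <= e1 * `|h| + e2 * `|k|.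
  have A2 : `|g (h + x) - g x - 'd g x h| <= e1 * `|h| by near: h; exact: H1.
  have A1 := H3h; rewrite /= -/k dPid {1}/k subrK in A1.
  have -> : k - 'd g x h =
      (g (h + x) - g x - 'd g x h) - (P (u (h + x)) - P (u x) - k).
    by rewrite /g /=; set X := P _ - P _; rewrite [- (X - k)]opprB [RHS]addrC addrA subrK.
  by apply: le_trans (ler_normB _ _) (lerD A2 A1).
have kb : `|k| <= 2 * (K + e1) * `|h|.
  have A := ler_normD (k - 'd g x h) ('d g x h); rewrite subrK in A.
  have B := HK h.
  have C : e2 * `|k| <= 1 / 2 * `|k| by rewrite ler_wpM2r // ge_min lexx.
  have E : `|k| <= e1 * `|h| + 1 / 2 * `|k| + K * `|h|.
    apply: le_trans A (lerD (le_trans hk _) B).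
    by rewrite lerD2l.
  have -> : 2 * (K + e1) * `|h| = 2 * (e1 * `|h| + K * `|h|) by ring.
  by move: E; set a := e1 * _; set b := K * _; lra.
apply: le_trans hk _.
have : e2 * `|k| <= e1 * `|h|.
  apply: le_trans (ler_wpM2l (ltW e20) kb) _; rewrite mulrA ler_wpM2r //.
  have : e2 <= e / (4 * (K + e1)) by rewrite ge_min lexx orbT.
  rewrite ler_pdivlMr ?mulr_gt0 // /e1; lra.
by rewrite /e1; lra.
Unshelve. all: by end_near. Qed.

End Diff.

(** * Maps of class C^k *)

Section CkTheory.
Variable R : realType.
Implicit Types V W : normedModType R.

Lemma Ck_ext V W k (f g : V -> W) U : open U -> {in U, f =1 g} ->
  Ck k f U -> Ck k g U.
Proof.
have near_eq h h' x : open U -> {in U, h =1 h'} -> U x -> {near x, (h : V -> W) =1 h'}.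
  move=> oU hh Ux; apply: (@filterS _ _ _ U); last exact: open_nbhs_nbhs.
  by move=> y Uy; apply: hh; rewrite inE.
move=> oU; elim: k f g => [|k IH] f g fg /=.
  move=> cf x Ux; have E := near_eq _ _ x oU fg Ux.
  rewrite /continuous_at /prop_for -(nbhs_singleton E).
  apply: cvg_trans (cf x Ux); apply: near_eq_cvg.
  by apply: filterS E => y ->.
move=> [df Df]; split=> [x Ux|v].
  by apply: near_differentiable (df x Ux); apply: near_eq.
apply: IH (Df v) => x; rewrite inE => Ux; apply: near_eq_derive.
exact: near_eq.
Qed.

Lemma eq_Ck V W k (f g : V -> W) U : f =1 g -> Ck k f U -> Ck k g U.
Proof. by move=> /funext ->. Qed.

Lemma CkS V W k (f : V -> W) U : Ck k.+1 f U -> Ck k f U.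
Proof.
elim: k f => [|k IH] f [df Df].
  by move=> x Ux; apply: differentiable_continuous; apply: df.
by split => // v; apply: IH.
Qed.

Lemma Ck_sub V W k (f : V -> W) (U U' : set V) : U' `<=` U -> Ck k f U -> Ck k f U'.
Proof.
move=> UU; elim: k f => [|k IH] f /=; first by move=> H x /UU; apply: H.
by move=> [df Df]; split=> [x /UU /df //|v]; apply: IH.
Qed.

Lemma Ck_cst V W k (c : W) (U : set V) : Ck k (fun=> c) U.
Proof.
elim: k c => [|k IH] c /=; first by move=> x _; exact: cvg_cst.
split=> [x _|v]; first exact: differentiable_cst.
rewrite (_ : (fun x => 'D_v (fun=> c) x) = fun=> 0); first exact: IH.
by apply/funext => x; apply: derive_cst.
Qed.

Lemma CkD V W k (f g : V -> W) U : open U -> Ck k f U -> Ck k g U ->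
  Ck k (fun x => f x + g x) U.
Proof.
move=> oU; elim: k f g => [|k IH] f g /=.
  by move=> cf cg x Ux; apply: cvgD; [apply: cf|apply: cg].
move=> [df Df] [dg Dg]; split=> [x Ux|v].
  by apply: differentiableD; [apply: df|apply: dg].
apply: Ck_ext (IH _ _ (Df v) (Dg v)) => // x; rewrite inE => Ux.
by rewrite deriveD //; apply: diff_derivable; [apply: df|apply: dg].
Qed.

Lemma CkM V k (f g : V -> R) U : open U -> Ck k f U -> Ck k g U ->
  Ck k (fun x => f x * g x) U.
Proof.
move=> oU; elim: k f g => [|k IH] f g.
  by move=> cf cg x Ux; apply: cvgM; [apply: cf|apply: cg].
move=> Cf Cg; have [df Df] := Cf; have [dg Dg] := Cg; split=> [x Ux|v].
  by apply: differentiableM; [apply: df|apply: dg].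
apply: (@Ck_ext _ _ _ (fun x => f x * 'D_v g x + g x * 'D_v f x)) => //.
  move=> x; rewrite inE => Ux.
  by rewrite deriveM //; apply: diff_derivable; [apply: df|apply: dg].
by apply: CkD => //; apply: IH; by [exact: CkS|exact: Df|exact: Dg].
Qed.

Lemma Ck_sum V k I (r : seq I) (P : pred I) (f : I -> V -> R) U : open U ->
  (forall i, P i -> Ck k (f i) U) -> Ck k (fun x => \sum_(i <- r | P i) f i x) U.
Proof.
move=> oU H; elim: r => [|i r IH].
  by apply: (eq_Ck _ (Ck_cst k (0 : R) U)) => x; rewrite big_nil.
have [Pi|Pi] := boolP (P i); last first.
  by apply: (eq_Ck _ IH) => x; rewrite big_cons (negbTE Pi).
apply: (@eq_Ck _ _ _ (fun x => f i x + \sum_(j <- r | P j) f j x)) => [x|].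
  by rewrite big_cons Pi.
by apply: CkD => //; exact: H.
Qed.

Lemma Ck_prod V k I (r : seq I) (P : pred I) (f : I -> V -> R) U : open U ->
  (forall i, P i -> Ck k (f i) U) -> Ck k (fun x => \prod_(i <- r | P i) f i x) U.
Proof.
move=> oU H; elim: r => [|i r IH].
  by apply: (eq_Ck _ (Ck_cst k (1 : R) U)) => x; rewrite big_nil.
have [Pi|Pi] := boolP (P i); last first.
  by apply: (eq_Ck _ IH) => x; rewrite big_cons (negbTE Pi).
apply: (@eq_Ck _ _ _ (fun x => f i x * \prod_(j <- r | P j) f j x)) => [x|].
  by rewrite big_cons Pi.
by apply: CkM => //; exact: H.
Qed.

Lemma Ck_det V k n (A : V -> 'M[R]_n) U : open U ->
  (forall i j, Ck k (fun x => A x i j) U) -> Ck k (fun x => \det (A x)) U.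
Proof.
move=> oU H; apply: Ck_sum => // s _; apply: CkM => //; first exact: Ck_cst.
by apply: Ck_prod => // i _; exact: H.
Qed.

Lemma Ck_adj V k n (A : V -> 'M[R]_n) U i j : open U ->
  (forall i j, Ck k (fun x => A x i j) U) -> Ck k (fun x => (\adj (A x)) i j) U.
Proof.
move=> oU H; apply: (@eq_Ck _ _ _ (fun x => cofactor (A x) j i)) => [x|].
  by rewrite mxE.
apply: CkM => //; first exact: Ck_cst.
apply: Ck_det => // a b.
by apply: (@eq_Ck _ _ _ (fun x => A x (lift j a) (lift i b))) => [x|//]; rewrite !mxE.
Qed.

Lemma CkV V k (f : V -> R) U : open U -> (forall x, U x -> f x != 0) ->
  Ck k f U -> Ck k (fun x => (f x)^-1) U.
Proof.
move=> oU f0; elim: k f f0 => [|k IH] f f0.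
  by move=> cf x Ux; apply: cvgV; [exact: f0|exact: cf].
move=> Cf; have [df Df] := Cf; split=> [x Ux|v].
  by apply: differentiableV; [exact: df|exact: f0].
have CVf : Ck k (fun x => (f x)^-1) U by apply: IH => //; exact: CkS.
apply: (@Ck_ext _ _ _ (fun x => (- 1) * ((f x)^-1 * (f x)^-1) * 'D_v f x)) => //.
  move=> x; rewrite inE => Ux.
  rewrite deriveV ?f0 //; last by apply: diff_derivable; exact: df.
  by rewrite /GRing.scale /= -exprVn expr2; ring.
by do 3?[apply: CkM => //]; [exact: Ck_cst|exact: Df].
Qed.

Lemma Ck_rVi V n k (f : V -> 'rV[R]_n) U i : open U -> Ck k f U ->
  Ck k (fun x => f x 0 i) U.
Proof.
move=> oU; elim: k f => [|k IH] f.
  move=> cf x Ux; apply: (@continuous_comp _ _ _ f (fun N : 'rV[R]_n => N 0 i)).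
    exact: cf.
  exact: coord_continuous.
move=> [df Df]; split=> [x Ux|v]; first by apply: differentiable_rVi; exact: df.
apply: Ck_ext (IH _ (Df v)) => // x; rewrite inE => Ux.
by rewrite derive_rVi //; exact: df.
Qed.

(** The directional derivatives of the composite are sums of products of
    derivatives of u and composites of derivatives of f with u, of class C^k by
    induction. *)
Lemma Ck_comp V n k (u : V -> 'rV[R]_n) (f : 'rV[R]_n -> R) U O :
  open U -> open O -> (forall x, U x -> {for x, continuous u}) -> 
  (forall x, U x -> O (u x)) ->
  (forall i, Ck k (fun x => u x 0 i) U) -> Ck k f O -> Ck k (f \o u) U.
Proof.
move=> oU oO cu UO; elim: k f => [|k IH] f.
  by move=> _ cf x Ux; apply: continuous_comp; [exact: cu|apply/cf/UO].
move=> Cu [df Df]; split=> [x Ux|v].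
  apply: differentiable_comp; last exact/df/UO.
  by apply: differentiable_rV => i; apply: (Cu i).1.
apply: (@Ck_ext _ _ _ (fun x => \sum_i 'D_v (fun y => u y 0 i) x
     * ('D_(delta_mx 0 i) f \o u) x)) => //.
  move=> x; rewrite inE => Ux; rewrite derive_comp_rV //; last exact/df/UO.
  by apply: differentiable_rV => i; apply: (Cu i).1.
apply: Ck_sum => // i _; apply: CkM => //; first exact: (Cu i).2.
by apply: IH => [j|]; [exact: CkS|exact: Df].
Qed.

(** The chain rule reads D_v(F o u) = D_v u * Jac(u) for row vectors, so that D_v u is
    D_v(F o u) times the inverse of Jac composed with u; the regularity of u can
    therefore be raised by one at each step, once u is known to be
    differentiable. *)
Lemma Ck_lift V n k (u : V -> 'rV[R]_n) (F : 'rV[R]_n -> 'rV[R]_n) U O :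
  let Jac y := \matrix_(i, j) 'D_(delta_mx 0 i) (fun z => F z 0 j) y in
  open U -> open O -> (forall x, U x -> {for x, continuous u}) -> 
  (forall x, U x -> O (u x)) ->
  (forall y, O y -> \det (Jac y) != 0) ->
  (forall j k, Ck k (fun y => F y 0 j) O) ->
  (forall j k, Ck k (fun x => F (u x) 0 j) U) ->
  forall i, Ck k (fun x => u x 0 i) U.
Proof.
move=> Jac oU oO cu UO detJ CF CFu.
have dF y : O y -> differentiable F y.
  by move=> Oy; apply: differentiable_rV => i; apply: (CF i 1).1.
have dFE y v : O y -> 'd F y v = v *m Jac y.
  move=> Oy; rewrite -deriveE; last exact: dF.
  apply/rowP => j; rewrite derive_rVi; last exact: dF.
  rewrite mxE deriveE; last exact: (CF j 1).1.
  rewrite {1}[v]row_sum_delta linear_sum; apply: eq_bigr => i _.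
  by rewrite linearZ mxE /= deriveE //; exact: (CF j 1).1.
have du x : U x -> differentiable u x.
  move=> Ux; pose A := invmx (Jac (u x)).
  have cA : continuous (mulmxr A : 'rV[R]_n -> 'rV[R]_n).
    move=> y; apply: differentiable_continuous; apply: differentiable_rV => i.
    under eq_fun do rewrite mxE.
    rewrite (_ : (fun _ => _) = \sum_j ((fun y : 'rV[R]_n => y 0 j) * cst (A j i))); last first.
      by apply/funext => z; rewrite fct_sumE.
    apply: differentiable_sum => j; apply: differentiableM => //.
    exact: differentiable_coord.
  have dA y : 'd (mulmxr A : 'rV[R]_n -> 'rV[R]_n) y = mulmxr A :> (_ -> _).
    exact: diff_lin.
  apply: (@differentiable_lift _ _ _ u (mulmxr A \o F) x) => //.
  - exact: cu.
  - by apply: differentiable_comp; [exact/dF/UO|exact: linear_differentiable].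
  - apply/funext => h; rewrite diff_comp //; [|exact/dF/UO|exact: linear_differentiable].
    apply: etrans (congr1 (@^~ ('d F (u x) h)) (dA (F (u x)))) _.
    rewrite (dFE _ _ (UO x Ux)).
    change (h *m Jac (u x) *m A = h).
    rewrite mulmxK //.
    by rewrite unitmxE unitfE; apply/detJ/UO.
  - rewrite -compA; apply: differentiable_comp; last exact: linear_differentiable.
    by apply: differentiable_rV => i; apply: (CFu i 1).1.
have Du x v i : U x -> 'D_v (fun y => u y 0 i) x =
    \sum_j 'D_v (fun y => F (u y) 0 j) x * ((\det (Jac (u x)))^-1 * (\adj (Jac (u x))) j i).
  move=> Ux; have /(congr1 (fun M => M *m invmx (Jac (u x)))) :
    \row_j 'D_v (fun y => F (u y) 0 j) x = 'D_v u x *m Jac (u x).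
    apply/rowP => j; rewrite !mxE (@derive_comp_rV _ _ _ u (fun y => F y 0 j)) //.
    - by apply: eq_bigr => l _; rewrite mxE derive_rVi //; exact: du.
    - exact: du.
    - by apply: (CF j 1).1; exact: UO.
  have uJ : Jac (u x) \in unitmx by rewrite unitmxE unitfE; apply/detJ/UO.
  rewrite mulmxK // -derive_rVi; last exact: du.
  move=> <-; rewrite mxE; apply: eq_bigr => j _; rewrite mxE; congr (_ * _).
  by rewrite /invmx uJ mxE.
elim: k => [|k IH] i.
  move=> x Ux; apply: (@continuous_comp _ _ _ u (fun N : 'rV[R]_n => N 0 i)).
    exact: cu.
  exact: coord_continuous.
split=> [x Ux|v]; first by apply: differentiable_rVi; exact: du.
apply: (@Ck_ext _ _ _ (fun x => \sum_j 'D_v (fun y => F (u y) 0 j) x *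
  ((fun y => (\det (Jac y))^-1 * (\adj (Jac y)) j i) \o u) x)) => //.
  by move=> x; rewrite inE => Ux; rewrite Du.
apply: Ck_sum => // j _; apply: CkM => //; first exact: (CFu j k.+1).2.
apply: (@Ck_comp _ _ _ _ _ _ O) => //.
have CJ a b : Ck k (fun x => Jac x a b) O.
  apply: (@eq_Ck _ _ _ (fun x => 'D_(delta_mx 0 a) (fun z => F z 0 b) x)) => [x|].
    by rewrite mxE.
  exact: (CF b k.+1).2.
apply: CkM => //; first by apply: CkV => //; exact: Ck_det.
exact: Ck_adj.
Qed.

End CkTheory.

(** * Germs of smooth functions on a manifold *)

Section NearOpen.
Variable T : topologicalType.

Lemma open_nearP (U : set T) :
  open U <-> (forall x, U x -> nbhs x U).
Proof. by rewrite openE. Qed.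

Lemma near_openP (x : T) (P : T -> Prop) :
  (\forall y \near x, P y) -> exists O, [/\ open O, O x & forall y, O y -> P y].
Proof.
move=> nP; exists (interior P); split=> //; first exact: open_interior.
exact: interior_subset.
Qed.

Lemma open_near (x : T) (O : set T) : open O -> O x ->
  \forall y \near x, O y.
Proof. by move=> oO Ox; apply: open_nbhs_nbhs. Qed.

End NearOpen.

Section Germs.
Variables (R : realType) (n : nat) (M : manifold R n).
Implicit Types (p q : M) (c : chart R n M) (f g : M -> R) (v w : tvec M) (O : set M).

Lemma cimgK c u : (cmap c @` cdom c) u ->
  cdom c (cinv c u) /\ cmap c (cinv c u) = u.
Proof. by move=> [q dq <-]; rewrite cmapK. Qed.

Lemma open_cimg c O : open O -> O `<=` cdom c -> open (cmap c @` O).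
Proof.
move=> oO Od; apply/open_nearP => _ [q Oq <-].
have Iq : (cmap c @` cdom c) (cmap c q) by exists q => //; exact: Od.
have := @cinv_continuous _ _ _ c _ Iq; rewrite /continuous_at /prop_for cmapK; last exact: Od.
move=> /(_ _ (open_near oO Oq)) H.
have H1 : \forall u \near cmap c q, O (cinv c u) by exact: H.
have H2 := open_near (@cim_open _ _ _ c) Iq.
near=> u; have [_ <-] : cdom c (cinv c u) /\ cmap c (cinv c u) = u.
  by apply: cimgK; near: u; exact: H2.
by exists (cinv c u) => //; near: u; exact: H1.
Unshelve. all: by end_near. Qed.

(** Smoothness can be tested in any chart around p.  The neighbourhood is taken
    on the manifold, where those for several functions and conditions can be
    intersected. *)
Lemma smooth_atP p c f : atlas c -> cdom c p ->
  smooth_at p f <-> exists O, [/\ open O, O p, O `<=` cdom c &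
    Coo (f \o cinv c) (cmap c @` O)].
Proof.
move=> ac dc; split; last first.
  move=> [ O [oO Op Od CO]]; exists c; split=> //; exists (cmap c @` O) => //.
  by split; [exact: open_cimg|exists p].
move=> [c0 [ac0 d0 [U [oU Up] CU]]].
pose O := cdom c `&` (cdom c0 `&` cmap c0 @^-1` U).
have oO : open O.
  apply: openI; first exact: cdom_open.
  apply/open_nearP => q [dq Uq]; apply: filterI.
    exact: open_near (@cdom_open _ _ _ c0) dq.
  by apply: (cmap_continuous dq); exact: (open_near oU Uq).
exists O; split=> // [q []//|k].
have Od : O `<=` cdom c by move=> q [].
have oI := open_cimg oO Od.
apply: (@Ck_ext _ _ _ _ ((f \o cinv c0) \o (cmap c0 \o cinv c))) => //.
  move=> u; rewrite inE => -[q [dq [dq0 _]] <-] /=.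
  by rewrite (cmapK dq) (cmapK dq0).
have CT k' : Ck k' (cmap c0 \o cinv c) (cmap c @` O).
  apply: Ck_sub (atlas_compat ac ac0 k') => u [q [dq [dq0 _]] <-].
  by exists q.
apply: (@Ck_comp _ _ _ _ (cmap c0 \o cinv c) (f \o cinv c0) _ U).
- exact: oI.
- exact: oU.
- by move=> x Ox; apply: (CT 0%N).
- by move=> u [q [dq [dq0 Uq]] <-] /=; rewrite (cmapK dq).
- by move=> i; apply: Ck_rVi.
- exact: CU.
Qed.

(** Used to work with finitely many germs and a local condition on one
    neighbourhood. *)
Lemma smooth_common p c (I : finType) (f : I -> M -> R) (P : M -> Prop) :
  atlas c -> cdom c p -> (forall i, smooth_at p (f i)) -> (\forall q \near p, P q) ->
  exists O, [/\ open O, O p, O `<=` cdom c, O `<=` P &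
    forall i, Coo (f i \o cinv c) (cmap c @` O)].
Proof.
move=> ac dc sf nP.
have H i : \forall q \near p, exists O, [/\ open O, O q, O `<=` cdom c &
    Coo (f i \o cinv c) (cmap c @` O)].
  have [ O [oO Op Od CO]] := (smooth_atP _ ac dc).1 (sf i).
  by apply: filterS (open_near oO Op) => q Oq; exists O.
pose G i := [set O | [/\ open O, O p, O `<=` cdom c &
    Coo (f i \o cinv c) (cmap c @` O)]].
have G0 i : exists O, G i O by exact: (smooth_atP _ ac dc).1 (sf i).
have [F HF] := choice G0.
have n1 : \forall q \near p, [/\ P q, cdom c q & forall i, F i q].
  near=> q; split; first by near: q.
    by near: q; apply: open_near => //; exact: cdom_open.
  by near: q; apply: filter_forall => i; have [oO Op _ _] := HF i; exact: open_near.
have [ O [oO Op OP]] := near_openP n1.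
exists O; split=> //; [by move=> q /OP[]|by move=> q /OP[]|].
move=> i k; have [_ _ _ /(_ k)] := HF i; apply: Ck_sub.
by move=> u [q /OP[_ _ Fq] <-]; exists q.
Unshelve. all: by end_near. Qed.

Lemma smooth_near p f : smooth_at p f -> \forall q \near p, smooth_at q f.
Proof.
move=> sf; have [c [ac dc _]] := sf.
have [ O [oO Op Od CO]] := (smooth_atP f ac dc).1 sf.
apply: filterS (open_near oO Op) => q Oq.
by apply/(smooth_atP f ac (Od _ Oq)); exists O.
Qed.

Lemma smooth_ext p f g : {near p, f =1 g} -> smooth_at p f -> smooth_at p g.
Proof.
move=> fg sf; have [c [ac dc _]] := sf.
have [ O [oO Op Od OP CO]] := @smooth_common p c 'I_1 (fun=> f) _ ac dc (fun=> sf) fg.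
apply/(smooth_atP _ ac dc); exists O; split=> // k.
apply: Ck_ext (CO ord0 k); first exact: open_cimg.
by move=> u; rewrite inE => -[q Oq <-] /=; rewrite cmapK; [exact: OP|exact: Od].
Qed.

Lemma smooth_cont p f : smooth_at p f -> {for p, continuous f}.
Proof.
move=> sf; have [c [ac dc _]] := sf.
have [ O [oO Op Od CO]] := (smooth_atP f ac dc).1 sf.
have h1 : f \o cinv c \o cmap c @ p --> f p.
  have H : f \o cinv c @ cmap c p --> f p.
    rewrite -{2}(cmapK dc); apply: (CO 0%N (cmap c p)); by exists p.
  by apply: cvg_comp H; exact: cmap_continuous.
rewrite /continuous_at /prop_for; apply: cvg_trans h1; apply: near_eq_cvg.
by apply: filterS (open_near oO Op) => q /Od dq /=; rewrite cmapK.
Qed.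

Lemma smooth_cst p (a : R) : smooth_at p (fun=> a).
Proof.
have [c ac dc] := atlas_cover p.
apply/(smooth_atP _ ac dc); exists (cdom c); split=> //; first exact: cdom_open.
by move=> k; apply: eq_Ck (Ck_cst k (a : R) _).
Qed.

Lemma smooth_op2 (op : R -> R -> R) p f g :
  (forall k (h h' : 'rV[R]_n -> R) U, open U -> Ck k h U -> Ck k h' U ->
     Ck k (fun u => op (h u) (h' u)) U) ->
  smooth_at p f -> smooth_at p g -> smooth_at p (fun q => op (f q) (g q)).
Proof.
move=> H sf sg; have [c [ac dc _]] := sf.
have [|O [oO Op Od OP CO]] := @smooth_common p c bool (fun b => if b then f else g)
  (fun=> True) ac dc _ (@filterT _ _ _); first by case.
apply/(smooth_atP _ ac dc); exists O; split=> // k.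
apply: H; [exact: open_cimg|exact: (CO true)|exact: (CO false)].
Qed.

Lemma smoothD p f g : smooth_at p f -> smooth_at p g ->
  smooth_at p (fun q => f q + g q).
Proof. by apply: smooth_op2 => k h h' U; exact: CkD. Qed.

Lemma smoothM p f g : smooth_at p f -> smooth_at p g ->
  smooth_at p (fun q => f q * g q).
Proof. by apply: smooth_op2 => k h h' U; exact: CkM. Qed.

Lemma smoothN p f : smooth_at p f -> smooth_at p (fun q => - f q).
Proof.
move=> sf; apply: (@smooth_ext _ (fun q => -1 * f q)).
  by apply: nearW => q; rewrite mulN1r.
by apply: smoothM => //; exact: smooth_cst.
Qed.

Lemma smooth_sum p (I : Type) (r : seq I) (P : pred I) (f : I -> M -> R) :
  (forall i, P i -> smooth_at p (f i)) ->
  smooth_at p (fun q => \sum_(i <- r | P i) f i q).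
Proof.
move=> H; elim: r => [|i r IH].
  by under eq_fun do rewrite big_nil; exact: smooth_cst.
have [Pi|Pi] := boolP (P i).
  by under eq_fun do rewrite big_cons Pi; apply: smoothD => //; exact: H.
by under eq_fun do rewrite big_cons (negbTE Pi).
Qed.

Lemma smooth_cont_rV p k (u : 'I_k -> M -> R) : (forall i, smooth_at p (u i)) ->
  {for p, continuous (fun q => \row_i u i q)}.
Proof.
move=> su; rewrite /continuous_at /prop_for; apply/cvgrPdist_lt => e e0.
have H : \forall q \near p, forall i, `|u i p - u i q| < e.
  by apply: filter_forall => i; have /cvgrPdist_lt/(_ _ e0) := smooth_cont (su i).
near=> q; have Hq : forall i, `|u i p - u i q| < e by near: q; exact: H.
rewrite [X in X < _]mx_normrE.
by apply/bigmax_ltP; split=> // i _; rewrite !mxE.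
Unshelve. all: by end_near. Qed.

Lemma smooth_comp_rV p m (u : 'I_m -> M -> R) (F : 'rV[R]_m -> R) U :
  (forall i, smooth_at p (u i)) -> open U -> U (\row_i u i p) -> Coo F U ->
  smooth_at p (fun q => F (\row_i u i q)).
Proof.
move=> su oU Up CF; have [c ac dc] := atlas_cover p.
have cu := smooth_cont_rV su.
have [ O [oO Op Od OP CO]] := @smooth_common p c _ u _ ac dc su (cu _ (open_near oU Up)).
apply/(smooth_atP _ ac dc); exists O; split=> // k.
pose u' := fun x => \row_i u i (cinv c x).
have Cu' k' i : Ck k' (fun x => u' x 0 i) (cmap c @` O).
  by apply: eq_Ck (CO i k') => x; rewrite mxE.
apply: (@Ck_comp _ _ _ _ u' F _ U).
- exact: open_cimg.
- exact: oU.
- move=> x Ox; apply: differentiable_continuous; apply: differentiable_rV => i.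
  by apply: (Cu' 1%N i).1.
- by move=> x [q Oq <-]; rewrite /u' (cmapK (Od _ Oq)); exact: OP.
- exact: Cu'.
- exact: CF.
Qed.

Lemma smoothV p f : smooth_at p f -> f p != 0 -> smooth_at p (fun q => (f q)^-1).
Proof.
move=> sf f0.
pose U := [set y : 'rV[R]_1 | y 0 0 != 0].
have oU : open U.
  apply: (@open_comp _ _ (fun y : 'rV[R]_1 => y 0 0) [set x | x != 0]).
    by move=> x _; exact: coord_continuous.
  exact: open_neq.
have CF : Coo (fun y : 'rV[R]_1 => (y 0 0)^-1) U.
  move=> k; apply: CkV => //; apply: (@Ck_rVi _ _ _ _ id) => //.
  elim: k => [|k IH]; first by move=> x _; exact: cvg_id.
  split => // [v]; apply: eq_Ck (Ck_cst k v U) => x; by rewrite derive_id.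
have := @smooth_comp_rV p 1 (fun=> f) _ U (fun=> sf) oU _ CF.
rewrite /U /= mxE => /(_ f0); apply: smooth_ext; apply: nearW => q; by rewrite mxE.
Qed.

Lemma smooth_det p m (A : M -> 'M[R]_m) : (forall i j, smooth_at p (fun q => A q i j)) ->
  smooth_at p (fun q => \det (A q)).
Proof.
move=> H; have [c ac dc] := atlas_cover p.
have [ O [oO Op Od _ CO]] := @smooth_common p c ('I_m * 'I_m)%type
   (fun ij q => A q ij.1 ij.2) (fun=> True) ac dc (fun ij => H _ _) (@filterT _ _ _).
apply/(smooth_atP _ ac dc); exists O; split=> // k.
apply: Ck_det; first exact: open_cimg.
by move=> i j; exact: (CO (i, j)).
Qed.

Lemma smooth_adj p m (A : M -> 'M[R]_m) i j : (forall i j, smooth_at p (fun q => A q i j)) ->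
  smooth_at p (fun q => (\adj (A q)) i j).
Proof.
move=> H; apply: (@smooth_ext _ (fun q => cofactor (A q) j i)).
  by apply: nearW => q; rewrite mxE.
apply: smoothM; first exact: smooth_cst.
apply: smooth_det => a b; apply: smooth_ext (H (lift j a) (lift i b)).
by apply: nearW => q; rewrite !mxE.
Qed.

Lemma smooth_chart c p i : atlas c -> cdom c p -> smooth_at p (fun q => cmap c q 0 i).
Proof.
move=> ac dc; apply/(smooth_atP _ ac dc); exists (cdom c); split=> //.
  exact: cdom_open.
move=> k; apply: (@Ck_ext _ _ _ _ (fun u : 'rV[R]_n => u 0 i : R)).
- exact: cim_open.
- by move=> u; rewrite inE => -[q dq <-] /=; rewrite (cmapK dq).
- apply: (@Ck_rVi _ _ _ _ id); first exact: cim_open.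
  elim: k => [|k IH]; first by move=> x _; exact: cvg_id.
  by split => // [v]; apply: eq_Ck (Ck_cst k v _) => x; rewrite derive_id.
Qed.

End Germs.

(** * Tangent vectors and bases *)

Section TangentVectors.
Variables (R : realType) (n : nat) (M : manifold R n).
Implicit Types (p q : M) (c : chart R n M) (f g : M -> R) (v w : tvec M).

Lemma germE p v f : smooth_at p f -> germ p v f = v f.
Proof. by rewrite /germ => /asboolP ->. Qed.

Lemma germ0 p v f : ~ smooth_at p f -> germ p v f = 0.
Proof. by rewrite /germ => /asboolPn /negbTE ->. Qed.

(** For a basis vector a this is a coordinate vector of the chart c. *)
Definition ctan c p (a : 'rV[R]_n) : tvec M :=
  germ p (fun f => 'D_a (f \o cinv c) (cmap c p)).

Lemma ctanE c p a f : smooth_at p f -> ctan c p a f = 'D_a (f \o cinv c) (cmap c p).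
Proof. exact: germE. Qed.

Lemma ctan0 c p a f : ~ smooth_at p f -> ctan c p a f = 0.
Proof. exact: germ0. Qed.

Lemma tv_scaleE a v f : (a *: v) f = a * v f. Proof. by []. Qed.

Lemma tv_addE v w f : (v + w) f = v f + w f. Proof. by []. Qed.

Lemma tv_oppE v f : (- v) f = - v f. Proof. by []. Qed.

Lemma ctan_tangent c p a : atlas c -> cdom c p -> is_tangent p (ctan c p a).
Proof. by move=> ac dc; exists c, a. Qed.

Lemma smooth_diff c p f : atlas c -> cdom c p -> smooth_at p f ->
  differentiable (f \o cinv c) (cmap c p).
Proof.
move=> ac dc /(smooth_atP _ ac dc) [ O [oO Op Od CO]].
by apply: (CO 1%N).1; exists p.
Qed.

Lemma ctan_sum c p a : atlas c -> cdom c p ->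
  ctan c p a = \sum_i a 0 i *: ctan c p (delta_mx 0 i).
Proof.
move=> ac dc; apply/funext => f; rewrite fct_sumE.
have [sf|nsf] := EM (smooth_at p f); last first.
  by rewrite ctan0 // big1 // => i _; rewrite tv_scaleE ctan0 // mulr0.
have df := smooth_diff ac dc sf.
rewrite ctanE // deriveE // {1}[a]row_sum_delta linear_sum.
apply: eq_bigr => i _; rewrite linearZ /= -deriveE //.
by rewrite tv_scaleE ctanE.
Qed.

Lemma tv_nonsmooth p v f : is_tangent p v -> ~ smooth_at p f -> v f = 0.
Proof. by move=> [c [a [_ _ ->]]] /germ0. Qed.

Lemma tv_germ p v : is_tangent p v -> v = germ p v.
Proof.
move=> tv; apply/funext => f; rewrite /germ; case: asboolP => // nsf.
exact: tv_nonsmooth tv nsf.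
Qed.

Lemma tv_near p v f g : is_tangent p v -> {near p, f =1 g} -> v f = v g.
Proof.
move=> tv fg; have [sf|nsf] := EM (smooth_at p f); last first.
  rewrite !(tv_nonsmooth tv) // => sg; apply: nsf; apply: smooth_ext sg.
  by apply: filterS fg.
have sg := smooth_ext fg sf.
have [c [a [ac dc ->]]] := tv; rewrite !germE //.
apply: near_eq_derive.
have [ O [oO Op Od OP _]] := smooth_common ac dc (fun _ : 'I_1 => sf) fg.
have oI := open_cimg oO Od.
apply: filterS (open_near oI (ex_intro2 _ _ p Op erefl)) => u [q Oq <-] /=.
by rewrite (cmapK (Od _ Oq)); exact: OP.
Qed.

Lemma tv_cst p v (a : R) : is_tangent p v -> v (fun=> a) = 0.
Proof.
move=> [c [b [ac dc ->]]]; rewrite germE; last exact: smooth_cst.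
by rewrite (_ : (fun=> a) \o cinv c = cst a) // derive_cst.
Qed.

Lemma tv_add p v f g : is_tangent p v -> smooth_at p f -> smooth_at p g ->
  v (fun q => f q + g q) = v f + v g.
Proof.
move=> [c [b [ac dc ->]]] sf sg; rewrite !germE //; last exact: smoothD.
rewrite -deriveD //; apply: diff_derivable; exact: smooth_diff.
Qed.

Lemma tv_mul p v f g : is_tangent p v -> smooth_at p f -> smooth_at p g ->
  v (fun q => f q * g q) = v f * g p + f p * v g.
Proof.
move=> [c [b [ac dc ->]]] sf sg; rewrite !germE //; last exact: smoothM.
rewrite (@deriveM _ _ (f \o cinv c) (g \o cinv c)); last 2 first.
- by apply: diff_derivable; exact: smooth_diff.
- by apply: diff_derivable; exact: smooth_diff.
by rewrite /= (cmapK dc) /GRing.scale /= addrC mulrC.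
Qed.

Lemma tv_opp p v f : is_tangent p v -> smooth_at p f -> v (fun q => - f q) = - v f.
Proof.
move=> tv sf; have := tv_add tv sf (smoothN sf).
rewrite (_ : (fun q => f q + - f q) = fun=> 0); last first.
  by apply/funext => q; rewrite subrr.
by rewrite (tv_cst _ tv) => /esym /eqP; rewrite addrC addr_eq0 => /eqP.
Qed.

Lemma tv_sum p v (I : Type) (r : seq I) (P : pred I) (f : I -> M -> R) :
  is_tangent p v -> (forall i, P i -> smooth_at p (f i)) ->
  v (fun q => \sum_(i <- r | P i) f i q) = \sum_(i <- r | P i) v (f i).
Proof.
move=> tv sf; elim: r => [|i r IH].
  rewrite big_nil; apply: etrans (tv_cst 0 tv).
  by congr v; apply/funext => q; rewrite big_nil.
rewrite big_cons; have [Pi|Pi] := boolP (P i); last first.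
  by rewrite -IH; congr v; apply/funext => q; rewrite big_cons (negbTE Pi).
rewrite -IH -(tv_add tv); [|exact: sf|exact: smooth_sum].
by congr v; apply/funext => q; rewrite big_cons Pi.
Qed.

Lemma tv_comp_rV p v m (u : 'I_m -> M -> R) (F : 'rV[R]_m -> R) U :
  is_tangent p v ->
  (forall i, smooth_at p (u i)) -> open U -> U (\row_i u i p) -> Coo F U ->
  v (fun q => F (\row_i u i q)) =
  \sum_i v (u i) * 'D_(delta_mx 0 i) F (\row_i u i p).
Proof.
move=> [c [b [ac dc ->]]] su oU Up CF.
rewrite germE; last exact: smooth_comp_rV CF.
pose u' := fun x => \row_i u i (cinv c x).
have u'p : u' (cmap c p) = \row_i u i p.
  by apply/rowP => i; rewrite !mxE (cmapK dc).
have du i : differentiable (fun y => u' y 0 i) (cmap c p).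
  rewrite (_ : (fun y => _) = u i \o cinv c); first exact: smooth_diff.
  by apply/funext => y; rewrite mxE.
rewrite (@derive_comp_rV _ _ _ u' F).
- rewrite u'p; apply: eq_bigr => i _; rewrite germE //.
  rewrite (_ : u i \o cinv c = fun y => u' y 0 i) //.
  by apply/funext => y; rewrite mxE.
- exact: differentiable_rV.
- by rewrite u'p; apply: (CF 1%N).1.
Qed.

(** Apply the chain rule to f = (f o c^-1) o c. *)
Lemma tangent_chart c p v : atlas c -> cdom c p -> is_tangent p v ->
  v = \sum_i v (fun q => cmap c q 0 i) *: ctan c p (delta_mx 0 i).
Proof.
move=> ac dc tv; apply/funext => f; rewrite fct_sumE.
have [sf|nsf] := EM (smooth_at p f); last first.
  rewrite (tv_nonsmooth tv nsf) big1 // => i _.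
  by rewrite tv_scaleE ctan0 // mulr0.
have /(smooth_atP _ ac dc)[ O [oO Op Od CO]] := sf.
have rowc q : \row_i cmap c q 0 i = cmap c q by apply/rowP => i; rewrite mxE.
have E : {near p, f =1 fun q => (f \o cinv c) (\row_i cmap c q 0 i)}.
  apply: filterS (open_near oO Op) => q Oq.
  by rewrite rowc /= (cmapK (Od _ Oq)).
rewrite (tv_near tv E) (@tv_comp_rV p v _ (fun i q => cmap c q 0 i) _ (cmap c @` O)) //.
- by apply: eq_bigr => i _; rewrite tv_scaleE ctanE // rowc.
- by move=> i; exact: smooth_chart.
- exact: open_cimg.
- by rewrite rowc; exists p.
Qed.

Lemma tangent_span c p (a : 'I_n -> R) : atlas c -> cdom c p ->
  is_tangent p (\sum_i a i *: ctan c p (delta_mx 0 i)).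
Proof.
move=> ac dc; exists c, (\row_i a i); split=> //.
rewrite -/(ctan c p (\row_i a i)) ctan_sum //.
by apply: eq_bigr => i _; rewrite mxE.
Qed.

Lemma tangentD p v w : is_tangent p v -> is_tangent p w -> is_tangent p (v + w).
Proof.
move=> tv tw; have [c ac dc] := atlas_cover p.
rewrite (tangent_chart ac dc tv) (tangent_chart ac dc tw) -big_split /=.
by under eq_bigr do rewrite -scalerDl; exact: tangent_span.
Qed.

Lemma tangentZ p a v : is_tangent p v -> is_tangent p (a *: v).
Proof.
move=> tv; have [c ac dc] := atlas_cover p.
rewrite (tangent_chart ac dc tv) scaler_sumr.
by under eq_bigr do rewrite scalerA; exact: tangent_span.
Qed.

Lemma tangent0 p : is_tangent p (0 : tvec M).
Proof.
have [c ac dc] := atlas_cover p; have := tangentZ 0 (ctan_tangent 0 ac dc).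
by rewrite scale0r.
Qed.

Lemma tangentN p v : is_tangent p v -> is_tangent p (- v).
Proof. by move=> tv; rewrite -scaleN1r; exact: tangentZ. Qed.

Lemma tangentB p v w : is_tangent p v -> is_tangent p w -> is_tangent p (v - w).
Proof. by move=> tv tw; apply: tangentD => //; exact: tangentN. Qed.

Lemma tangent_sum p (I : Type) (r : seq I) (P : pred I) (v : I -> tvec M) :
  (forall i, P i -> is_tangent p (v i)) -> is_tangent p (\sum_(i <- r | P i) v i).
Proof.
by move=> tv; elim/big_ind: _ => //; [exact: tangent0|move=> x y; exact: tangentD].
Qed.

Lemma ctan_cmap c p i j : atlas c -> cdom c p ->
  ctan c p (delta_mx 0 i) (fun q => cmap c q 0 j) = (i == j)%:R.
Proof.
move=> ac dc; rewrite ctanE; last exact: smooth_chart.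
rewrite (near_eq_derive (g := fun u : 'rV[R]_n => u 0 j)).
  by rewrite -derive_rVi ?derive_id ?mxE // eq_sym.
have Ip : (cmap c @` cdom c) (cmap c p) by exists p.
apply: filterS (open_near (@cim_open _ _ _ c) Ip) => u [q dq <-] /=.
by rewrite (cmapK dq).
Qed.

Lemma coordP p (e : 'I_n -> tvec M) v : is_basis p e -> is_tangent p v ->
  v = \sum_i Defs.coord e v 0 i *: e i.
Proof.
move=> [te be] /be [a [va _]].
exact: (@xgetI _ 0 [set a : 'rV[R]_n | v = \sum_i a 0 i *: e i] a va).
Qed.

Lemma coordE p (e : 'I_n -> tvec M) (a : 'I_n -> R) i : is_basis p e ->
  Defs.coord e (\sum_i a i *: e i) 0 i = a i.
Proof.
move=> [te be]; set v := \sum_i _.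
have tv : is_tangent p v by apply: tangent_sum => j _; exact: tangentZ.
have [b [vb ub]] := be v tv.
have bc := ub _ (coordP (conj te be) tv).
have ba : b = \row_i a i.
  by apply: ub; rewrite /v; apply: eq_bigr => j _; rewrite mxE.
by rewrite -bc ba mxE.
Qed.

(** A linear relation between the rows is a linear combination of the vectors
    on which all the separating functions vanish. *)
Lemma separating_row_free p k N (e : 'I_k -> tvec M) (psi : 'I_N -> M -> R) :
  (forall i, is_tangent p (e i)) ->
  (forall a : 'rV[R]_k, \sum_i a 0 i *: e i = 0 -> a = 0) ->
  (forall v, is_tangent p v -> (forall j, v (psi j) = 0) -> v = 0) ->
  row_free (\matrix_(i, j) e i (psi j)).
Proof.
move=> te fe sep; set A := \matrix_(_, _) _.
rewrite -kermx_eq0; apply/eqP/row_matrixP => l; rewrite row0.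
have : row l (kermx A) *m A = 0 by rewrite -row_mul mulmx_ker row0.
move: (row l _) => a aA; apply/fe/sep.
  by apply: tangent_sum => i _; exact: tangentZ.
move=> j; have /rowP/(_ j) := aA; rewrite !mxE fct_sumE => aAj.
by rewrite -[RHS]aAj; apply: eq_bigr => i _; rewrite mxE.
Qed.

Lemma chart_separates c p v : atlas c -> cdom c p -> is_tangent p v ->
  (forall j, v (fun q => cmap c q 0 j) = 0) -> v = 0.
Proof.
move=> ac dc tv v0; rewrite (tangent_chart ac dc tv).
by rewrite big1 // => i _; rewrite v0 scale0r.
Qed.

Lemma basis_free p (e : 'I_n -> tvec M) (a : 'rV[R]_n) : is_basis p e ->
  \sum_i a 0 i *: e i = 0 -> a = 0.
Proof.
move=> be a0; apply/rowP => k; rewrite mxE -(coordE (fun i => a 0 i) k be) a0.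
rewrite -(coordE (fun=> 0) k be); congr (Defs.coord _ _ _ _).
by rewrite big1 // => j _; rewrite scale0r.
Qed.

Lemma basis_of_free p (e : 'I_n -> tvec M) : (forall i, is_tangent p (e i)) ->
  (forall a : 'rV[R]_n, \sum_i a 0 i *: e i = 0 -> a = 0) -> is_basis p e.
Proof.
move=> te fe; split=> // v tv; have [c ac dc] := atlas_cover p.
pose x i q := cmap c q 0 i.
pose A := \matrix_(i, j) e i (x j).
have eA (a : 'rV[R]_n) : \sum_i a 0 i *: e i =
    \sum_j (a *m A) 0 j *: ctan c p (delta_mx 0 j).
  rewrite (eq_bigr (fun i => \sum_j (a 0 i * A i j) *: ctan c p (delta_mx 0 j))).
    rewrite exchange_big; apply: eq_bigr => j _.
    by rewrite -scaler_suml mxE.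
  move=> i _; rewrite {1}(tangent_chart ac dc (te i)) scaler_sumr.
  by apply: eq_bigr => j _; rewrite mxE scalerA.
have uA : A \in unitmx.
  rewrite -row_free_unit; apply: (separating_row_free te fe) => w tw w0.
  exact: (chart_separates ac dc tw w0).
exists (\row_j v (x j) *m invmx A); split.
  rewrite eA mulmxKV // {1}(tangent_chart ac dc tv).
  by apply: eq_bigr => j _; rewrite mxE.
move=> b; rewrite eA => vb.
suff -> : \row_j v (x j) = b *m A by rewrite mulmxK.
apply/rowP => j; rewrite mxE vb fct_sumE (bigD1 j) //= big1.
  by rewrite tv_scaleE ctan_cmap // eqxx mulr1 addr0.
move=> i ij; rewrite tv_scaleE ctan_cmap // (negbTE ij) mulr0 //.
Qed.

Lemma ctan_basis c p : atlas c -> cdom c p ->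
  is_basis p (fun i => ctan c p (delta_mx 0 i)).
Proof.
move=> ac dc; apply: basis_of_free => [i|a a0]; first exact: ctan_tangent.
apply/rowP => j; rewrite mxE.
have /(congr1 (fun v : tvec M => v (fun q => cmap c q 0 j))) := a0.
rewrite fct_sumE (bigD1 j) //= big1.
  by rewrite tv_scaleE ctan_cmap // eqxx mulr1 addr0.
by move=> i ij; rewrite tv_scaleE ctan_cmap // (negbTE ij) mulr0.
Qed.

(** The trace is defined from an arbitrary basis; independence is the usual
    tr (P B P^-1) = tr B. *)
Lemma traceE p e (A : tvec M -> tvec M) : is_basis p e ->
  (forall x, is_tangent p x -> is_tangent p (A x)) ->
  (forall (a : 'I_n -> R), A (\sum_i a i *: e i) = \sum_i a i *: A (e i)) ->
  trace p A = \sum_i Defs.coord e (A (e i)) 0 i.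
Proof.
move=> be tA lA; apply: xget_unique; first by exists e.
move=> _ [e' be' ->].
have te i : is_tangent p (e i) by apply: be.1.
have te' i : is_tangent p (e' i) by apply: be'.1.
pose P := \matrix_(i, j) Defs.coord e (e' i) 0 j.
pose Q := \matrix_(i, j) Defs.coord e' (e i) 0 j.
pose B := \matrix_(i, j) Defs.coord e (A (e i)) 0 j.
have eP i : e' i = \sum_j P i j *: e j.
  by rewrite {1}(coordP be (te' i)); apply: eq_bigr => j _; rewrite mxE.
have eQ i : e i = \sum_j Q i j *: e' j.
  by rewrite {1}(coordP be' (te i)); apply: eq_bigr => j _; rewrite mxE.
have eB i : A (e i) = \sum_j B i j *: e j.
  by rewrite {1}(coordP be (tA _ (te i))); apply: eq_bigr => j _; rewrite mxE.
have swap m (x : 'I_m -> R) (X : 'M[R]_(m, n)) (b : 'I_n -> tvec M) :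
    \sum_i x i *: (\sum_j X i j *: b j) = \sum_j (\sum_i x i * X i j) *: b j.
  under eq_bigr do rewrite scaler_sumr.
  rewrite exchange_big; apply: eq_bigr => j _; rewrite scaler_suml.
  by apply: eq_bigr => i _; rewrite scalerA.
have QP : Q *m P = 1%:M.
  apply/matrixP => i j; rewrite mxE -(coordE (fun j => \sum_k Q i k * P k j) j be).
  rewrite -swap; under eq_bigr do rewrite -eP; rewrite -eQ.
  rewrite -(coordE (fun j => (1%:M : 'M[R]_n) i j) j be); congr (Defs.coord e _ _ _).
  rewrite (bigD1 i) //= big1 ?mxE ?eqxx ?scale1r ?addr0 //.
  by move=> k ki; rewrite mxE eq_sym (negbTE ki) scale0r.
have E i : A (e' i) = \sum_j (P *m B *m Q) i j *: e' j.
  rewrite {1}eP lA; under eq_bigr do rewrite eB.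
  rewrite swap; under eq_bigr do rewrite eQ; rewrite swap.
  apply: eq_bigr => j _; congr (_ *: _).
  by rewrite [RHS]mxE; apply: eq_bigr => k _; congr (_ * _); rewrite [RHS]mxE.
transitivity (\tr (P *m B *m Q)).
  apply: eq_bigr => i _; rewrite E.
  by rewrite (coordE (fun j => (P *m B *m Q) i j) i be').
rewrite mxtrace_mulC mulmxA QP mul1mx.
by apply: eq_bigr => i _; rewrite mxE.
Qed.

End TangentVectors.

(** * Vector fields and connections along a map *)

Section MapsFields.
Variables (R : realType) (m n : nat) (P : manifold R m) (Q : manifold R n).
Variable h : P -> Q.
Hypothesis sh : smooth_map h.
Implicit Types (p q : P) (V : P -> tvec Q) (Y : Q -> tvec Q) (X : P -> tvec P).

Lemma smooth_pull p f : smooth_at (h p) f -> smooth_at p (f \o h).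
Proof. exact: sh.2. Qed.

Lemma near_pull p (A : Q -> Prop) : (\forall r \near h p, A r) ->
  \forall q \near p, A (h q).
Proof. by move=> nA; apply: (sh.1 p). Qed.

Lemma dmapE p v f : smooth_at (h p) f -> dmap h p v f = v (f \o h).
Proof. exact: germE. Qed.

Lemma dmap_linear p (a : R) v w : dmap h p (a *: v + w) = a *: dmap h p v + dmap h p w.
Proof.
apply/funext => f; rewrite -[RHS]/(_ * _ + _) /dmap /germ.
by case: asboolP => // _; rewrite mulr0 addr0.
Qed.

Lemma dmap0 p : dmap h p 0 = 0.
Proof. by apply/funext => f; rewrite /dmap /germ; case: ifP. Qed.

Lemma dmapZ p (a : R) v : dmap h p (a *: v) = a *: dmap h p v.
Proof. by rewrite -[a *: v]addr0 dmap_linear dmap0 addr0. Qed.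

Lemma dmapD p v w : dmap h p (v + w) = dmap h p v + dmap h p w.
Proof. by rewrite -{1}[v]scale1r dmap_linear scale1r. Qed.

Lemma dmapB p v w : dmap h p (v - w) = dmap h p v - dmap h p w.
Proof. by rewrite dmapD -[- w]scaleN1r dmapZ scaleN1r. Qed.

(** The chain rule in a chart around h p: the components of the image are the
    derivatives of the coordinates of h. *)
Lemma dmap_tangent p v : is_tangent p v -> is_tangent (h p) (dmap h p v).
Proof.
move=> tv; have [c ac dc] := atlas_cover (h p).
pose x i q := cmap c (h q) 0 i.
have sx i : smooth_at p (x i).
  by apply: (@smooth_pull p (fun r => cmap c r 0 i)); exact: smooth_chart.
suff -> : dmap h p v = \sum_i v (x i) *: ctan c (h p) (delta_mx 0 i).
  exact: tangent_span.
apply/funext => f; rewrite fct_sumE.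
have [sf|nsf] := EM (smooth_at (h p) f); last first.
  by rewrite [LHS]germ0 // big1 // => i _; rewrite tv_scaleE ctan0 // mulr0.
rewrite dmapE //.
have /(smooth_atP _ ac dc)[ O [oO Op Od CO]] := sf.
have rowc q : \row_i x i q = cmap c (h q) by apply/rowP => i; rewrite mxE.
have E : {near p, f \o h =1 fun q => (f \o cinv c) (\row_i x i q)}.
  apply: filterS (near_pull (open_near oO Op)) => q Oq.
  by rewrite rowc /= (cmapK (Od _ Oq)).
rewrite (tv_near tv E) (@tv_comp_rV _ _ _ p v _ x _ (cmap c @` O)) //.
- by apply: eq_bigr => i _; rewrite tv_scaleE ctanE // rowc.
- exact: open_cimg.
- by rewrite rowc; exists (h p).
Qed.

Lemma along_near V p : smooth_along h V p -> \forall q \near p, smooth_along h V q.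
Proof. exact: near_join. Qed.

Lemma along_tan V p : smooth_along h V p -> is_tangent (h p) (V p).
Proof. by move=> /nbhs_singleton[]. Qed.

Lemma along_smooth V p f : smooth_along h V p -> smooth_at (h p) f ->
  smooth_at p (fun q => V q f).
Proof. by move=> /nbhs_singleton[_]; apply. Qed.

Lemma along_ext V V' p : {near p, V =1 V'} -> smooth_along h V p -> smooth_along h V' p.
Proof.
move=> VV sV; have VV' := near_join VV; near=> q.
have Eq : {near q, V =1 V'} by near: q; exact: VV'.
have [tV sVf] : is_tangent (h q) (V q) /\
    forall f, smooth_at (h q) f -> smooth_at q (fun r => V r f) by near: q; exact: sV.
rewrite -(nbhs_singleton Eq); split=> // f /sVf; apply: smooth_ext.
by apply: filterS Eq => r ->.
Unshelve. all: by end_near. Qed.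

Lemma alongD V V' p : smooth_along h V p -> smooth_along h V' p ->
  smooth_along h (fun q => V q + V' q) p.
Proof.
move=> /along_near sV /along_near sV'; near=> q.
have Vq : smooth_along h V q by near: q.
have Vq' : smooth_along h V' q by near: q.
split; first by apply: tangentD; exact: along_tan.
move=> f sf; apply: (@smooth_ext _ _ _ q (fun r => V r f + V' r f)).
  exact: nearW.
by apply: smoothD; exact: along_smooth.
Unshelve. all: by end_near. Qed.

Lemma alongZ (a : P -> R) V p : smooth_at p a -> smooth_along h V p ->
  smooth_along h (fun q => a q *: V q) p.
Proof.
move=> /smooth_near sa /along_near sV; near=> q.
have aq : smooth_at q a by near: q.
have Vq : smooth_along h V q by near: q.
split; first by apply: tangentZ; exact: along_tan.
move=> f sf; apply: (@smooth_ext _ _ _ q (fun r => a r * V r f)).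
  exact: nearW.
by apply: smoothM => //; exact: along_smooth.
Unshelve. all: by end_near. Qed.

Lemma along0 p : smooth_along h (fun=> 0) p.
Proof. by apply: nearW => q; split; [exact: tangent0|move=> f _; exact: smooth_cst]. Qed.

Lemma along_sum (I : Type) (r : seq I) (V : I -> P -> tvec Q) p :
  (forall i, smooth_along h (V i) p) -> smooth_along h (fun q => \sum_(i <- r) V i q) p.
Proof.
move=> sV; elim: r => [|i r IH].
  by under eq_fun do rewrite big_nil; exact: along0.
by under eq_fun do rewrite big_cons; exact: alongD.
Qed.

Lemma along_push X p : smooth_field X p -> smooth_along h (fun q => dmap h q (X q)) p.
Proof.
move=> sX; near=> q.
have [tX sXf] : is_tangent q (X q) /\
    forall f, smooth_at q f -> smooth_at q (fun r => X r f) by near: q; exact: sX.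
split=> [|f sf]; first exact: dmap_tangent.
apply: (smooth_ext _ (sXf _ (smooth_pull sf))).
by apply: filterS (near_pull (smooth_near sf)) => r sfr; rewrite dmapE.
Unshelve. all: by end_near. Qed.

Lemma along_pull Y p : smooth_field Y (h p) -> smooth_along h (Y \o h) p.
Proof.
move=> /near_pull sY; near=> q.
have [tY sYf] : is_tangent (h q) (Y (h q)) /\
    forall f, smooth_at (h q) f -> smooth_at (h q) (fun r => Y r f).
  by near: q; exact: sY.
by split=> // f /sYf /smooth_pull.
Unshelve. all: by end_near. Qed.

Lemma basis_chart_unit c r (e : 'I_n -> tvec Q) : atlas c -> cdom c r -> is_basis r e ->
  \matrix_(i, j) e i (fun s => cmap c s 0 j) \in unitmx.
Proof.
move=> ac dc be; rewrite -row_free_unit; apply: (separating_row_free be.1).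
  by move=> a; exact: (basis_free be).
by move=> v tv; exact: (chart_separates ac dc tv).
Qed.

(** Solve the linear system that expresses the chart components of V by those of
    the frame; Cramer's formula is smooth in the coefficients. *)
Lemma smooth_coord (F : 'I_n -> Q -> tvec Q) V p i :
  (forall j, smooth_field (F j) (h p)) ->
  (\forall r \near h p, is_basis r (fun j => F j r)) ->
  smooth_along h V p ->
  smooth_at p (fun q => Defs.coord (fun j => F j (h q)) (V q) 0 i).
Proof.
move=> sF bF sV; have [c ac dc] := atlas_cover (h p).
pose A q := \matrix_(i, j) F i (h q) (fun s => cmap c s 0 j).
have sA a b : smooth_at p (fun q => A q a b).
  apply: (@smooth_ext _ _ _ p (fun q => F a (h q) (fun s => cmap c s 0 b))).
    by apply: nearW => q; rewrite mxE.
  exact: (along_smooth (along_pull (sF a)) (smooth_chart b ac dc)).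
have uA q : cdom c (h q) -> is_basis (h q) (fun j => F j (h q)) -> A q \in unitmx.
  by move=> dq bq; exact: (basis_chart_unit ac dq bq).
apply: (@smooth_ext _ _ _ p (fun q => \sum_j V q (fun s => cmap c s 0 j) *
   ((\det (A q))^-1 * (\adj (A q)) j i))); last first.
  apply: smooth_sum => j _; apply: smoothM.
    by apply: along_smooth => //; exact: smooth_chart.
  apply: smoothM; last exact: smooth_adj.
  apply: smoothV; first exact: smooth_det.
  by rewrite -unitfE -unitmxE; apply: uA => //; exact: nbhs_singleton bF.
near=> q.
have dq : cdom c (h q).
  by near: q; apply: near_pull; apply: open_near => //; exact: cdom_open.
have bq : is_basis (h q) (fun j => F j (h q)) by near: q; exact: near_pull bF.
have tV : is_tangent (h q) (V q).
  by near: q; apply: filterS sV => q [].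
have uAq := uA q dq bq.
have E : \row_j V q (fun s => cmap c s 0 j) =
   Defs.coord (fun j => F j (h q)) (V q) *m A q.
  apply/rowP => j; rewrite !mxE {1}(coordP bq tV) fct_sumE.
  by apply: eq_bigr => k _; rewrite mxE.
have -> : Defs.coord (fun j => F j (h q)) (V q) =
   \row_j V q (fun s => cmap c s 0 j) *m invmx (A q) by rewrite E mulmxK.
rewrite [RHS]mxE; apply: eq_bigr => j _.
by rewrite [X in _ = X * _]mxE; congr (_ * _); rewrite /invmx uAq [RHS]mxE.
Unshelve. all: by end_near. Qed.

Variable D : P -> tvec P -> (P -> tvec Q) -> tvec Q.
Hypothesis cD : connection_along h D.

Lemma conn_tan p x V : is_tangent p x -> smooth_along h V p -> is_tangent (h p) (D p x V).
Proof. by case: cD => H _ _ _ _; exact: H. Qed.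

Lemma connD p x V V' : is_tangent p x -> smooth_along h V p -> smooth_along h V' p ->
  D p x (fun q => V q + V' q) = D p x V + D p x V'.
Proof. by case: cD => _ _ H _ _; exact: H. Qed.

Lemma conn_leibniz p x f V : is_tangent p x -> smooth_at p f -> smooth_along h V p ->
  D p x (fun q => f q *: V q) = x f *: V p + f p *: D p x V.
Proof. by case: cD => _ _ _ H _; exact: H. Qed.

(** Multiplying by the indicator function of a neighbourhood on which the
    sections agree makes them equal everywhere, and this function is locally
    constant at p. *)
Lemma conn_local p x V V' : is_tangent p x -> smooth_along h V p ->
  {near p, V =1 V'} -> D p x V = D p x V'.
Proof.
move=> tx sV VV; have sV' := along_ext VV sV.
have [ O [oO Op OV]] := near_openP VV.
pose f q : R := if `[< O q >] then 1 else 0.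
have f1 : {near p, (fun=> 1) =1 f}.
  by apply: filterS (open_near oO Op) => q Oq; rewrite /f asboolT.
have sf := smooth_ext f1 (smooth_cst p 1).
have fp : f p = 1 by rewrite /f asboolT.
have xf : x f = 0 by rewrite -(tv_near tx f1) (tv_cst _ tx).
have : D p x (fun q => f q *: V q) = D p x (fun q => f q *: V' q).
  congr (D p x _); apply/funext => q; rewrite /f.
  by case: asboolP => [/OV ->|_]; rewrite ?scale0r.
by rewrite !conn_leibniz // fp xf !scale0r !add0r !scale1r.
Qed.

Lemma conn0 p x : is_tangent p x -> D p x (fun=> 0) = 0.
Proof.
move=> tx; have := conn_leibniz tx (smooth_cst p 0) (along0 p).
rewrite (tv_cst _ tx) !scale0r addr0 => {2}<-.
by congr (D p x _); apply/funext => q; rewrite scale0r.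
Qed.

Lemma conn_sum (I : Type) (r : seq I) p x (f : I -> P -> R) (V : I -> P -> tvec Q) :
  is_tangent p x -> (forall i, smooth_at p (f i)) -> (forall i, smooth_along h (V i) p) ->
  D p x (fun q => \sum_(i <- r) f i q *: V i q) =
  \sum_(i <- r) (x (f i) *: V i p + f i p *: D p x (V i)).
Proof.
move=> tx sf sV; elim: r => [|i r IH].
  by rewrite big_nil; under [X in D p x X]eq_fun do rewrite big_nil; exact: conn0.
rewrite big_cons -IH -conn_leibniz // -connD //.
- by congr (D p x _); apply/funext => q; rewrite big_cons.
- exact: alongZ.
- by apply: along_sum => j; exact: alongZ.
Qed.

(** A pulled-back connection is determined by its values on the fields of a
    local frame of the target. *)
Lemma pullback_frame nabla (F : 'I_n -> Q -> tvec Q) p x V :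
  (forall p x Y, is_tangent p x -> smooth_field Y (h p) ->
    D p x (Y \o h) = nabla (h p) (dmap h p x) Y) ->
  (forall j, smooth_field (F j) (h p)) ->
  (\forall r \near h p, is_basis r (fun j => F j r)) ->
  is_tangent p x -> smooth_along h V p ->
  let a i q := Defs.coord (fun j => F j (h q)) (V q) 0 i in
  D p x V = \sum_i (x (a i) *: F i (h p) + a i p *: nabla (h p) (dmap h p x) (F i)).
Proof.
move=> pD sF bF tx sV a.
have sa i : smooth_at p (a i) by exact: smooth_coord.
have E : {near p, V =1 fun q => \sum_i a i q *: F i (h q)}.
  near=> q; rewrite /a -(@coordP _ _ _ (h q)) //.
    by near: q; exact: near_pull bF.
  by near: q; apply: filterS sV => q [].
rewrite (conn_local tx sV E) conn_sum //; last by move=> i; exact: along_pull.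
by apply: eq_bigr => i _; rewrite -pD.
Unshelve. all: by end_near. Qed.

End MapsFields.

Section Fields.
Variables (R : realType) (n : nat) (M : manifold R n).

Lemma smooth_map_id : smooth_map (id : M -> M).
Proof. by split=> // p; exact: cvg_id. Qed.

Lemma dmap_id (p : M) v : is_tangent p v -> dmap (id : M -> M) p v = v.
Proof. by move=> tv; rewrite [RHS](tv_germ tv). Qed.

Lemma ctan_smooth (c : chart R n M) a p : atlas c -> cdom c p ->
  smooth_field (fun q => ctan c q a) p.
Proof.
move=> ac dc; near=> q.
have dq : cdom c q by near: q; apply: open_near => //; exact: cdom_open.
split=> [|f sf]; first exact: ctan_tangent.
have /(smooth_atP _ ac dq)[ O [oO Op Od CO]] := sf.
have oI := open_cimg oO Od.
apply/(smooth_atP _ ac dq); exists O; split=> // k.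
apply: Ck_ext ((CO k.+1).2 a) => // u; rewrite inE => -[r Or <-] /=.
rewrite (cmapK (Od _ Or)) ctanE //.
by apply/(smooth_atP _ ac (Od _ Or)); exists O.
Unshelve. all: by end_near. Qed.

End Fields.

(** * Weitzenboeck manifolds: parallel frame and torsion *)

Section Weitzenbock.
Variables (R : realType) (Mt : weitzenbock R).
Implicit Types (r : Mt) (v w : tvec Mt).
Local Notation E := (wframe (w := Mt)).

Lemma wcoordP r v : is_tangent r v -> v = \sum_i wcoord r v 0 i *: E i r.
Proof. by move=> tv; exact: coordP (wframe_basis r) tv. Qed.

Lemma wcoordE r (a : 'I_3 -> R) i : wcoord r (\sum_i a i *: E i r) 0 i = a i.
Proof. exact: coordE (wframe_basis r). Qed.

Lemma wframe_tangent r i : is_tangent r (E i r).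
Proof. exact: (wframe_basis r).1. Qed.

Lemma wcoord_linear r (a : R) v w : is_tangent r v -> is_tangent r w ->
  wcoord r (a *: v + w) = a *: wcoord r v + wcoord r w.
Proof.
move=> tv tw; apply/rowP => i.
rewrite {1}(wcoordP tv) {1}(wcoordP tw) scaler_sumr -big_split /=.
under eq_bigr do rewrite scalerA -scalerDl.
by rewrite (wcoordE r (fun i => a * wcoord r v 0 i + wcoord r w 0 i)) !mxE.
Qed.

Lemma wcoord0 r : wcoord r 0 = 0.
Proof.
by have := wcoord_linear (-1) (tangent0 r) (tangent0 r); rewrite scaler0 addr0 scaleN1r addNr.
Qed.

Lemma wcoordZ r (a : R) v : is_tangent r v -> wcoord r (a *: v) = a *: wcoord r v.
Proof.
by move=> tv; rewrite -[a *: v]addr0 wcoord_linear ?wcoord0 ?addr0 //; exact: tangent0.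
Qed.

Lemma wcoordD r v w : is_tangent r v -> is_tangent r w ->
  wcoord r (v + w) = wcoord r v + wcoord r w.
Proof. by move=> tv tw; rewrite -{1}[v]scale1r wcoord_linear // scale1r. Qed.

Lemma wcoordB r v w : is_tangent r v -> is_tangent r w ->
  wcoord r (v - w) = wcoord r v - wcoord r w.
Proof.
move=> tv tw; rewrite wcoordD ?tangentN //; last exact: tangentN.
by rewrite -scaleN1r wcoordZ // scaleN1r.
Qed.

Lemma wcoord_inj r v w : is_tangent r v -> is_tangent r w ->
  wcoord r v = wcoord r w -> v = w.
Proof. by move=> tv tw e; rewrite (wcoordP tv) (wcoordP tw) e. Qed.

(** Frame fields are parallel, so the torsion of the i-th and the j-th one is
    minus their bracket; this is the bilinear extension. *)
Definition wtorsion r v w : tvec Mt :=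
  - \sum_i \sum_j (wcoord r v 0 i * wcoord r w 0 j) *: bracket (E i) (E j) r.

Section Along.
Variables (m : nat) (P : manifold R m) (h : P -> Mt).
Hypothesis sh : smooth_map h.
Implicit Types (p q : P) (V : P -> tvec Mt) (X Y : P -> tvec P).

Lemma wcoord_smooth V p i : smooth_along h V p ->
  smooth_at p (fun q => wcoord (h q) (V q) 0 i).
Proof.
apply: (smooth_coord sh); first by move=> j; exact: wframe_smooth.
by apply: nearW => r; exact: wframe_basis.
Qed.

Lemma weitz_pullback D p x V : is_pullback (wconn (w := Mt)) h D ->
  is_tangent p x -> smooth_along h V p ->
  D p x V = \sum_i x (fun q => wcoord (h q) (V q) 0 i) *: E i (h p).
Proof.
move=> [cD pD] tx sV.
rewrite (pullback_frame sh cD pD (fun j => wframe_smooth j _) _ tx sV); last first.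
  by apply: nearW => r; exact: wframe_basis.
apply: eq_bigr => i _; rewrite wconn_frame ?scaler0 ?addr0 //.
exact: dmap_tangent.
Qed.

Lemma wcoord_pullback D p x V i : is_pullback (wconn (w := Mt)) h D ->
  is_tangent p x -> smooth_along h V p ->
  wcoord (h p) (D p x V) 0 i = x (fun q => wcoord (h q) (V q) 0 i).
Proof. by move=> pD tx sV; rewrite (weitz_pullback pD) // wcoordE. Qed.

(** For a function f on the target, Y(f o h) is the sum of b_i (E_i f) o h.
    Differentiating along X and antisymmetrizing, the derivatives of the
    coefficients give the first sum and those of E_i f give the brackets of the
    frame fields.  It is applied to the inclusion of the surface and, to
    identify the ambient torsion, to the identity. *)
Lemma structure_equation X Y p : smooth_field X p -> smooth_field Y p ->
  let a i q := wcoord (h q) (dmap h q (X q)) 0 i in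
  let b i q := wcoord (h q) (dmap h q (Y q)) 0 i in
  \sum_i (X p (b i) - Y p (a i)) *: E i (h p) - dmap h p (bracket X Y p) =
  wtorsion (h p) (dmap h p (X p)) (dmap h p (Y p)).
Proof.
move=> sX sY a b; apply/funext => f.
have tX := along_tan sX; have tY := along_tan sY; rewrite /= in tX tY.
have [sf|nsf] := EM (smooth_at (h p) f); last first.
  have nE i j : bracket (E i) (E j) (h p) f = 0 by rewrite /bracket germ0.
  rewrite -[LHS]/(_ f - _) [X in _ - X]germ0 // subr0 /wtorsion.
  rewrite -[RHS]/(- _ f) !fct_sumE !big1 ?oppr0 // => i _.
    by rewrite fct_sumE big1 // => j _; rewrite tv_scaleE nE mulr0.
  by rewrite tv_scaleE (tv_nonsmooth (wframe_tangent _ _) nsf) mulr0.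
pose e i r := E i r f.
have se i : smooth_at (h p) (e i) by exact: (along_smooth (wframe_smooth i _) sf).
have sa i : smooth_at p (a i) by apply: wcoord_smooth; exact: along_push.
have sb i : smooth_at p (b i) by apply: wcoord_smooth; exact: along_push.
(* Z (Z' (f o h)) by the chain rule, with Z' expanded in the frame *)
have key (Z Z' : P -> tvec P) (z' : 'I_3 -> P -> R) : smooth_field Z p -> smooth_field Z' p ->
    (forall i, smooth_at p (z' i)) ->
    (forall i q, z' i q = wcoord (h q) (dmap h q (Z' q)) 0 i) ->
    Z p (fun q => Z' q (f \o h)) =
    \sum_i (Z p (z' i) * e i (h p) + z' i p *
      \sum_j wcoord (h p) (dmap h p (Z p)) 0 j * E j (h p) (e i)).
  move=> sZ sZ' sz' zE; have tZ : is_tangent p (Z p) := along_tan sZ.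
  have H : {near p, (fun q => Z' q (f \o h)) =1 fun q => \sum_i z' i q * (e i \o h) q}.
    near=> q.
    have sfq : smooth_at (h q) f by near: q; exact: (near_pull sh (smooth_near sf)).
    have tq : is_tangent q (Z' q) by near: q; apply: filterS sZ' => q [].
    rewrite -(dmapE _ sfq) (wcoordP (dmap_tangent sh tq)) fct_sumE.
    by apply: eq_bigr => i _; rewrite tv_scaleE zE.
  have sei i : smooth_at p (e i \o h) by exact: smooth_pull.
  rewrite (tv_near tZ H) (tv_sum _ tZ); last by move=> i _; exact: smoothM.
  apply: eq_bigr => i _; rewrite (tv_mul tZ) //; congr (_ + _ * _).
  by rewrite -(dmapE (Z p) (se i)) {1}(wcoordP (dmap_tangent sh tZ)) fct_sumE.
rewrite -[LHS]/(_ f - _) dmapE // fct_sumE /bracket germE; last exact: smooth_pull.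
rewrite (key X Y b) // (key Y X a) // /wtorsion -[RHS]/(- _ f) fct_sumE.
have -> : \sum_i (\sum_j (wcoord (h p) (dmap h p (X p)) 0 i *
     wcoord (h p) (dmap h p (Y p)) 0 j) *: bracket (E i) (E j) (h p)) f =
  \sum_i \sum_j (a i p * b j p) * E i (h p) (e j) -
  \sum_i \sum_j (a i p * b j p) * E j (h p) (e i).
  rewrite -sumrB; apply: eq_bigr => i _; rewrite fct_sumE -sumrB.
  by apply: eq_bigr => j _; rewrite tv_scaleE /bracket germE // mulrBr.
rewrite !big_split /= [X in _ - (X + _ - _)](_ : _ = \sum_i X p (b i) * e i (h p)) //.
have -> : \sum_i ((X p (b i) - Y p (a i)) *: E i (h p)) f =
  \sum_i X p (b i) * e i (h p) - \sum_i Y p (a i) * e i (h p).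
  by rewrite -sumrB; apply: eq_bigr => i _; rewrite tv_scaleE mulrBl.
have -> : \sum_i b i p * \sum_j wcoord (h p) (dmap h p (X p)) 0 j * E j (h p) (e i) =
   \sum_i \sum_j (a i p * b j p) * E i (h p) (e j).
  rewrite exchange_big; apply: eq_bigr => i _; rewrite mulr_sumr.
  by apply: eq_bigr => j _; rewrite mulrA [b i p * _]mulrC.
have -> : \sum_i a i p * \sum_j wcoord (h p) (dmap h p (Y p)) 0 j * E j (h p) (e i) =
   \sum_i \sum_j (a i p * b j p) * E j (h p) (e i).
  apply: eq_bigr => i _; rewrite mulr_sumr.
  by apply: eq_bigr => j _; rewrite mulrA.
ring.
Unshelve. all: by end_near. Qed.

End Along.

Lemma wconn_pullback : is_pullback (wconn (w := Mt)) id (wconn (w := Mt)).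
Proof.
split; first exact: wconn_connection.
by move=> p x Y tx sY; rewrite dmap_id.
Qed.

Lemma const_frame_field_smooth r (a : 'I_3 -> R) : smooth_field (fun q => \sum_i a i *: E i q) r.
Proof.
apply: (@along_sum _ _ _ Mt Mt id _ _ (fun i q => a i *: E i q)) => i.
apply: (@alongZ _ _ _ Mt Mt id (fun=> a i)); first exact: smooth_cst.
exact: wframe_smooth.
Qed.

Lemma torsion_fieldE X Y r : smooth_field X r -> smooth_field Y r ->
  torsion_field (wconn (w := Mt)) X Y r = wtorsion r (X r) (Y r).
Proof.
move=> sX sY.
have tX : is_tangent r (X r) := along_tan sX.
have tY : is_tangent r (Y r) := along_tan sY.
have idX Z : smooth_field Z r -> forall i, {near r, (fun q => wcoord q (Z q) 0 i) =1
     fun q => wcoord q (dmap id q (Z q)) 0 i}.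
  by move=> sZ i; apply: filterS sZ => q [tq _]; rewrite dmap_id.
have Eb : dmap id r (bracket X Y r) = bracket X Y r.
  apply/funext => f; rewrite /dmap; have [sf|nsf] := EM (smooth_at r f).
    by rewrite germE.
  by rewrite /bracket !germ0.
have := structure_equation (@smooth_map_id _ _ Mt) sX sY.
rewrite /= Eb (dmap_id tX) (dmap_id tY) => <-; rewrite /torsion_field.
rewrite (weitz_pullback (@smooth_map_id _ _ Mt) wconn_pullback tX sY).
rewrite (weitz_pullback (@smooth_map_id _ _ Mt) wconn_pullback tY sX).
rewrite -sumrB; congr (_ - _); apply: eq_bigr => i _; rewrite -scalerBl.
by rewrite -(tv_near tX (idX Y sY i)) -(tv_near tY (idX X sX i)).
Qed.

(** Extend the vectors with constant coefficients in the frame. *)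
Lemma torsion_wconn r v w : is_tangent r v -> is_tangent r w ->
  torsion (wconn (w := Mt)) r v w = wtorsion r v w.
Proof.
move=> tv tw; apply: xget_unique; last first.
  by move=> t [X [Y [sX sY <- <- ->]]]; exact: torsion_fieldE.
exists (fun q => \sum_i wcoord r v 0 i *: E i q),
  (fun q => \sum_i wcoord r w 0 i *: E i q); split.
- exact: const_frame_field_smooth.
- exact: const_frame_field_smooth.
- by rewrite -wcoordP.
- by rewrite -wcoordP.
- rewrite torsion_fieldE; [|exact: const_frame_field_smooth|exact: const_frame_field_smooth].
  by rewrite -!wcoordP.
Qed.

End Weitzenbock.

(** * Lifting a smooth map through an immersion *)

Section ImmersionLift.
Variables (R : realType) (m n N : nat) (P : manifold R m) (Q : manifold R n).

Lemma immersion_row_free (q : Q) (psi : 'I_N -> Q -> R) c : atlas c -> cdom c q ->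
  (forall v, is_tangent q v -> (forall i, v (psi i) = 0) -> v = 0) ->
  row_free (\matrix_(k, i) ctan c q (delta_mx 0 k) (psi i)).
Proof.
move=> ac dc sep.
apply: (separating_row_free (p := q) (e := fun k => ctan c q (delta_mx 0 k))) => // [k|a].
  exact: ctan_tangent.
exact: (basis_free (ctan_basis ac dc)).
Qed.

(** A left inverse B of the differential of psi turns psi into a map F between
    spaces of the same dimension whose Jacobian matrix is the identity at g p,
    hence invertible nearby; [Ck_lift] then applies to F o g in charts. *)
Lemma immersion_lift (g : P -> Q) (p : P) (psi : 'I_N -> Q -> R) f :
  continuous g ->
  (forall i, smooth_at (g p) (psi i)) ->
  (forall v, is_tangent (g p) v -> (forall i, v (psi i) = 0) -> v = 0) ->
  (forall i, smooth_at p (psi i \o g)) ->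
  smooth_at (g p) f -> smooth_at p (f \o g).
Proof.
move=> cg spsi imm spsig sf.
have [c ac dc] := atlas_cover (g p); have [c' ac' dc'] := atlas_cover p.
have /row_freeP[B AB] := immersion_row_free ac dc imm.
pose F j r := \sum_i psi i r * B i j.
have sF j : smooth_at (g p) (F j).
  by apply: smooth_sum => i _; apply: smoothM => //; exact: smooth_cst.
have sFg j : smooth_at p (F j \o g).
  apply: smooth_sum => i _; apply: smoothM; [exact: spsig|exact: smooth_cst].
pose J r : 'M[R]_n := \matrix_(k, j) ctan c r (delta_mx 0 k) (F j).
have sJ : smooth_at (g p) (fun r => \det (J r)).
  apply: smooth_det => k j; apply: (@smooth_ext _ _ _ _
    (fun r => ctan c r (delta_mx 0 k) (F j))); first by apply: nearW => r; rewrite mxE.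
  exact: (nbhs_singleton (ctan_smooth (delta_mx 0 k) ac dc)).2 _ (sF j).
have J1 : J (g p) = 1%:M.
  rewrite -AB; apply/matrixP => k j; rewrite !mxE.
  have tk := ctan_tangent (delta_mx 0 k) ac dc.
  rewrite (tv_sum _ tk); last by move=> i _; apply: smoothM => //; exact: smooth_cst.
  apply: eq_bigr => i _; rewrite (tv_mul tk) //; last exact: smooth_cst.
  by rewrite (tv_cst _ tk) mulr0 addr0 mxE.
have nJ : \forall r \near g p, \det (J r) != 0.
  have J0 : [set x : R | x != 0] (\det (J (g p))) by rewrite /= J1 det1 oner_neq0.
  by have := smooth_cont sJ (open_near (@open_neq R 0) J0).
have nFs : \forall r \near g p, forall j, smooth_at r (F j).
  by apply: filter_forall => j; exact: smooth_near.
have [ O [oO Op Od OJ CF]] := smooth_common ac dc sF (filterI nJ nFs).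
have [ O' [oO' Op' Od' OO' CFg]] := smooth_common ac' dc' sFg (cg p _ (open_near oO Op)).
pose u x := cmap c (g (cinv c' x)).
pose G y : 'rV[R]_n := \row_j F j (cinv c y).
have oI := open_cimg oO Od; have oI' := open_cimg oO' Od'.
have sxg j : smooth_at p (fun q => cmap c (g q) 0 j).
  apply/(smooth_atP _ ac' dc'); exists O'; split=> // k.
  apply: (@Ck_lift _ _ _ k u G (cmap c' @` O') (cmap c @` O)) => //.
  - move=> x [q O'q <-].
    apply: (@continuous_comp _ _ _ (g \o cinv c') (cmap c)).
      apply: continuous_comp; last exact: cg.
      by apply: cinv_continuous; exists q => //; exact: Od'.
    by rewrite /= (cmapK (Od' _ O'q)); apply: cmap_continuous; exact/Od/OO'.
  - by move=> x [q O'q <-]; rewrite /u (cmapK (Od' _ O'q)); exists (g q) => //; exact: OO'.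
  - move=> y [r Or <-]; have [Jr sFr] := OJ _ Or.
    rewrite (_ : \matrix_(_, _) _ = J r) //; apply/matrixP => a b; rewrite !mxE ctanE //.
    by congr ('D_ _ _ _); apply/funext => z; rewrite mxE.
  - move=> i l; apply: eq_Ck (CF i l) => y; by rewrite mxE.
  - move=> i l; apply: (@Ck_ext _ _ _ _ (F i \o g \o cinv c')) (CFg i l) => //.
    move=> x; rewrite inE => -[q O'q <-]; rewrite /G /u mxE /= (cmapK (Od' _ O'q)).
    by rewrite cmapK //; apply/Od/OO'.
have /(smooth_atP _ ac dc)[ O1 [oO1 Op1 Od1 CO1]] := sf.
have rowc r : \row_i cmap c r 0 i = cmap c r by apply/rowP => i; rewrite mxE.
apply: (@smooth_ext _ _ _ _ (fun q => (f \o cinv c) (\row_i cmap c (g q) 0 i))).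
  have H : \forall q \near p, O1 (g q) by apply: (cg p); exact: open_near.
  by apply: filterS H => q O1q; rewrite rowc /= (cmapK (Od1 _ O1q)).
apply: (@smooth_comp_rV _ _ _ p n (fun i q => cmap c (g q) 0 i) _ (cmap c @` O1)) => //.
  exact: open_cimg.
by rewrite rowc; exists (g p).
Qed.

End ImmersionLift.

(** * The round sphere *)

Section Dot.
Variables (R : realType) (n : nat).
Implicit Types (x y z : 'rV[R]_n) (a : R).

Definition dot x y : R := \sum_i x 0 i * y 0 i.

Lemma dotC x y : dot x y = dot y x.
Proof. by apply: eq_bigr => i _; rewrite mulrC. Qed.

Lemma dotDl x y z : dot (x + y) z = dot x z + dot y z.
Proof. by rewrite -big_split; apply: eq_bigr => i _; rewrite mxE mulrDl. Qed.

Lemma dotZl a x y : dot (a *: x) y = a * dot x y.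
Proof. by rewrite mulr_sumr; apply: eq_bigr => i _; rewrite mxE mulrA. Qed.

Lemma dotDr x y z : dot x (y + z) = dot x y + dot x z.
Proof. by rewrite dotC dotDl !(dotC _ x). Qed.

Lemma dotZr a x y : dot x (a *: y) = a * dot x y.
Proof. by rewrite dotC dotZl dotC. Qed.

Lemma dotNl x y : dot (- x) y = - dot x y.
Proof. by rewrite -scaleN1r dotZl mulN1r. Qed.

Lemma dotNr x y : dot x (- y) = - dot x y.
Proof. by rewrite dotC dotNl dotC. Qed.

Lemma dot0l x : dot 0 x = 0.
Proof. by rewrite -[0](scale0r 0) dotZl mul0r. Qed.

Lemma dot_suml (I : Type) (r : seq I) (P : pred I) (F : I -> 'rV[R]_n) y :
  dot (\sum_(i <- r | P i) F i) y = \sum_(i <- r | P i) dot (F i) y.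
Proof. exact: (big_morph (dot^~ y) (fun x z => dotDl x z y) (dot0l y)). Qed.

Lemma dot_mulmx x y : x *m y^T = (dot x y)%:M.
Proof.
apply/matrixP => i j; rewrite !ord1 !mxE eqxx mulr1n; apply: eq_bigr => k _.
by rewrite !mxE.
Qed.

End Dot.

Section Sphere.
Variables (R : realType) (S2 : unit_sphere R).
Implicit Types (q : S2) (v w : tvec S2).
Notation U := (upt (u := S2)).

Lemma ucoordD v w : ucoord (v + w) = ucoord v + ucoord w.
Proof. by apply/rowP => i; rewrite !mxE. Qed.

Lemma ucoordZ (a : R) v : ucoord (a *: v) = a *: ucoord v.
Proof. by apply/rowP => i; rewrite !mxE. Qed.

Lemma ucoordB v w : ucoord (v - w) = ucoord v - ucoord w.
Proof. by apply/rowP => i; rewrite !mxE. Qed.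

Lemma ucoord0 : ucoord (0 : tvec S2) = 0.
Proof. by apply/rowP => i; rewrite !mxE. Qed.

Lemma ucoord_sum (I : Type) (r : seq I) (F : I -> tvec S2) :
  ucoord (\sum_(i <- r) F i) = \sum_(i <- r) ucoord (F i).
Proof. exact: (big_morph _ ucoordD ucoord0). Qed.

Lemma ucoord_eq0 q v : is_tangent q v -> ucoord v = 0 -> v = 0.
Proof.
move=> tv v0; apply: (upt_immersion tv) => i.
by have /rowP/(_ i) := v0; rewrite !mxE.
Qed.

Lemma ucoord_inj q v w : is_tangent q v -> is_tangent q w -> ucoord v = ucoord w -> v = w.
Proof.
move=> tv tw vw; apply/eqP; rewrite -subr_eq0; apply/eqP.
by apply: (ucoord_eq0 (tangentB tv tw)); rewrite ucoordB vw subrr.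
Qed.

Lemma dot_upt q : dot (U q) (U q) = 1.
Proof.
have : range U (U q) by exists q.
by rewrite upt_range /= => <-; apply: eq_bigr => i _; rewrite expr2.
Qed.

Lemma dot_upt_ucoord q v : is_tangent q v -> dot (ucoord v) (U q) = 0.
Proof.
move=> tv; have : v (fun r => dot (U r) (U r)) = 0.
  by rewrite -(tv_cst 1 tv); congr v; apply/funext => r; rewrite dot_upt.
rewrite (tv_sum _ tv); last by move=> i _; apply: smoothM; exact: upt_smooth.
rewrite (eq_bigr (fun i => (ucoord v) 0 i * U q 0 i + (ucoord v) 0 i * U q 0 i)).
  by rewrite big_split /= -/(dot _ _); lra.
by move=> i _; rewrite (tv_mul tv); try exact: upt_smooth; rewrite mxE [X in _ + X]mulrC.
Qed.

(** The image of the tangent plane lies in the orthogonal complement of the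
    position vector; both have dimension two. *)
Lemma ucoord_surj q (y : 'rV[R]_3) : dot y (U q) = 0 ->
  exists2 v, is_tangent q v & ucoord v = y.
Proof.
move=> yq; have [c ac dc] := atlas_cover q.
set A := \matrix_(k, i) ctan c q (delta_mx 0 k) (fun r => U r 0 i).
have fA : row_free A.
  apply: (immersion_row_free (psi := fun i r => U r 0 i)) => // v tv v0.
  exact: (upt_immersion tv v0).
have rA k : row k A = ucoord (ctan c q (delta_mx 0 k)).
  by apply/rowP => i; rewrite !mxE.
have AK : (A <= kermx (U q)^T)%MS.
  apply/sub_kermxP/row_matrixP => k; rewrite row_mul rA row0 dot_mulmx.
  by rewrite dot_upt_ucoord ?scalemx1 ?scale0r //; [rewrite raddf0|exact: ctan_tangent].
have rK : \rank (kermx (U q)^T) = 2.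
  rewrite mxrank_ker mxrank_tr rank_rV.
  case: eqP => // U0; have := dot_upt q; rewrite U0 dot0l => /eqP.
  by rewrite eq_sym oner_eq0.
have KA : (kermx (U q)^T <= A)%MS.
  by rewrite -(mxrank_leqif_sup AK) rK; move: fA; rewrite /row_free => /eqP ->.
have /(fun H => submx_trans H KA)/submxP[d yE] : (y <= kermx (U q)^T)%MS.
  by apply/sub_kermxP; rewrite dot_mulmx yq raddf0.
exists (\sum_k d 0 k *: ctan c q (delta_mx 0 k)); first exact: (tangent_span (fun k => d 0 k)).
rewrite ucoord_sum yE; apply/rowP => i; rewrite summxE mxE.
by apply: eq_bigr => k _; rewrite !mxE.
Qed.

Section LeviCivita.
Variable nS : connection S2.
Hypothesis lc : is_levi_civita (round_metric (S2 := S2)) nS.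

(** Let S(X, Y, Z) be the difference of the two sides.  It is symmetric in X, Y
    because neither term has torsion, and antisymmetric in Y, Z because both are
    compatible with the metric; a trilinear form with these symmetries is
    zero. *)
Lemma sphere_lc_fields q X Y Z : smooth_field X q -> smooth_field Y q -> smooth_field Z q ->
  dot (ucoord (nS q (X q) Y)) (ucoord (Z q)) =
  dot (\row_i X q (fun r => Y r (fun s => U s 0 i))) (ucoord (Z q)).
Proof.
have [_ tf mc] := lc.
pose d (X Y : S2 -> tvec S2) : 'rV[R]_3 := \row_i X q (fun r => Y r (fun s => U s 0 i)).
pose S (X Y Z : S2 -> tvec S2) :=
  dot (ucoord (nS q (X q) Y)) (ucoord (Z q)) - dot (d X Y) (ucoord (Z q)).
have sym X' Y' Z' : smooth_field X' q -> smooth_field Y' q -> S X' Y' Z' = S Y' X' Z'.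
  move=> sX sY; have := tf q X' Y' sX sY; rewrite /torsion_field => T0.
  have : ucoord (nS q (X' q) Y' - nS q (Y' q) X') = d X' Y' - d Y' X'.
    have -> : nS q (X' q) Y' - nS q (Y' q) X' = bracket X' Y' q.
      by apply/eqP; rewrite -subr_eq0 T0.
    by apply/rowP => i; rewrite !mxE /bracket germE //; exact: upt_smooth.
  rewrite ucoordB => H; apply/eqP; rewrite -subr_eq0 /S.
  have := congr1 (fun y => dot y (ucoord (Z' q))) H.
  by rewrite !(dotDl, dotNl) => H'; apply/eqP; move: H'; lra.
have antisym X' Y' Z' : smooth_field X' q -> smooth_field Y' q -> smooth_field Z' q ->
    S X' Y' Z' = - S X' Z' Y'.
  move=> sX sY sZ; have tX : is_tangent q (X' q) := along_tan sX.
  have := mc q (X' q) Y' Z' tX sY sZ.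
  have su V i : smooth_field V q -> smooth_at q (fun r => V r (fun s => U s 0 i)).
    by move=> sV; apply: (along_smooth sV); exact: upt_smooth.
  rewrite [X in X = _](_ : _ = dot (d X' Y') (ucoord (Z' q)) + dot (d X' Z') (ucoord (Y' q))).
    rewrite /round_metric -!/(dot _ _) (dotC (ucoord (Y' q))) /S; lra.
  rewrite [X in X' q X](_ : _ = fun r => \sum_i Y' r (fun s => U s 0 i) * Z' r (fun s => U s 0 i)).
    rewrite (tv_sum _ tX); last by move=> i _; apply: smoothM; exact: su.
    rewrite /dot -big_split; apply: eq_bigr => i _.
    rewrite (tv_mul tX); try exact: su.
    by rewrite !mxE; congr (_ + _); rewrite mulrC.
  by apply/funext => r; apply: eq_bigr => i _; rewrite !mxE.
move=> sX sY sZ; suff : S X Y Z = 0 by rewrite /S => /eqP; rewrite subr_eq0 => /eqP.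
have E1 := sym X Y Z sX sY. have E2 := antisym Y X Z sY sX sZ.
have E3 := sym Y Z X sY sZ. have E4 := antisym Z Y X sZ sY sX.
have E5 := sym Z X Y sZ sX. have E6 := antisym X Z Y sX sZ sY.
lra.
Qed.

Variables (m : nat) (P : manifold R m) (g : P -> S2).
Hypothesis sg : smooth_map g.
Variable DS : P -> tvec P -> (P -> tvec S2) -> tvec S2.
Hypothesis hDS : is_pullback nS g DS.

Lemma sphere_pullback p x V z : is_tangent p x -> smooth_along g V p ->
  is_tangent (g p) z ->
  dot (ucoord (DS p x V)) (ucoord z) =
  dot (\row_i x (fun q : P => ucoord (V q) 0 i)) (ucoord z).
Proof.
move=> tx sV tz; have [c ac dc] := atlas_cover (g p).
pose F (k : 'I_2) r := ctan c r (delta_mx 0 k).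
have sF k : smooth_field (F k) (g p) by exact: ctan_smooth.
have bF : \forall r \near g p, is_basis r (fun k => F k r).
  have := open_near (@cdom_open _ _ _ c) dc; apply: filterS => r dr.
  exact: ctan_basis.
have bFp := nbhs_singleton bF.
pose a k (q : P) := Defs.coord (fun k => F k (g q)) (V q) 0 k.
have sa k : smooth_at p (a k) by exact: smooth_coord.
pose ext (v : tvec S2) r := \sum_k Defs.coord (fun k => F k (g p)) v 0 k *: F k r.
have sext v : smooth_field (ext v) (g p).
  pose b k := Defs.coord (fun k => F k (g p)) v 0 k.
  apply: (@along_sum _ _ _ S2 S2 id _ _ (fun k r => b k *: F k r)) => k.
  by apply: (@alongZ _ _ _ S2 S2 id (fun=> b k)); [exact: smooth_cst|exact: sF].
have extE v : is_tangent (g p) v -> ext v (g p) = v.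
  by move=> tv; rewrite /ext -(coordP bFp).
have tdx := dmap_tangent sg tx.
have lcF k : dot (ucoord (nS (g p) (dmap g p x) (F k))) (ucoord z) =
    dot (\row_i x (fun q : P => F k (g q) (fun s => U s 0 i))) (ucoord z).
  have := sphere_lc_fields (sext (dmap g p x)) (sF k) (sext z).
  rewrite !extE // => ->; congr (dot _ _); apply/rowP => i; rewrite !mxE dmapE //.
  by apply: (along_smooth (sF k)); exact: upt_smooth.
rewrite (pullback_frame sg hDS.1 hDS.2 sF bF tx sV) -/a.
have -> : \row_i x (fun q : P => ucoord (V q) 0 i) =
   \sum_k (x (a k) *: ucoord (F k (g p)) +
            a k p *: \row_i x (fun q : P => F k (g q) (fun s => U s 0 i))).
  have sFu k i : smooth_at p (fun q : P => F k (g q) (fun s => U s 0 i)).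
    apply: (along_smooth (along_pull sg (sF k))); exact: upt_smooth.
  apply/rowP => i; rewrite mxE summxE.
  have H : {near p, (fun q : P => ucoord (V q) 0 i) =1
     fun q : P => \sum_k a k q * F k (g q) (fun s => U s 0 i)}.
    near=> q.
    have tV : is_tangent (g q) (V q) by near: q; apply: filterS sV => q [].
    have bq : is_basis (g q) (fun k => F k (g q)) by near: q; exact: (near_pull sg bF).
    by rewrite mxE {1}(coordP bq tV) fct_sumE; apply: eq_bigr => k _; rewrite tv_scaleE.
  rewrite (tv_near tx H) (tv_sum _ tx); last by move=> k _; apply: smoothM.
  by apply: eq_bigr => k _; rewrite (tv_mul tx) // !mxE.
rewrite ucoord_sum !dot_suml; apply: eq_bigr => k _.
by rewrite ucoordD !ucoordZ !dotDl !dotZl lcF.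
Unshelve. all: by end_near. Qed.

End LeviCivita.

(** Continuity comes from the embedding being a homeomorphism onto its image,
    smoothness from [immersion_lift]. *)
Lemma smooth_into_sphere (m : nat) (P : manifold R m) (g : P -> S2) :
  (forall p i, smooth_at p (fun q : P => U (g q) 0 i)) -> smooth_map g.
Proof.
move=> sUg.
have cg : continuous g.
  move=> p A nA; have [ O [oO Op OA]] := near_openP nA.
  have [V oV OV] := (upt_homeo S2).2 O oO.
  have cU : {for p, continuous (U \o g)}.
    rewrite (_ : U \o g = fun q : P => \row_i U (g q) 0 i); first exact: smooth_cont_rV.
    by apply/funext => q; apply/rowP => i; rewrite mxE.
  have VUp : V (U (g p)) by move: Op; rewrite OV.
  have H : \forall q \near p, V (U (g q)) := cU _ (open_near oV VUp).
  change (\forall q \near p, A (g q)); apply: filterS H => q Vq.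
  by apply: OA; rewrite OV.
split=> // p f; apply: (immersion_lift (psi := fun i r => U r 0 i)) => //.
- by move=> i; exact: upt_smooth.
- by move=> v tv v0; exact: (upt_immersion tv v0).
- by move=> i; exact: sUg.
Qed.

End Sphere.

(** * Pointwise geometry of the surface *)

Lemma det_mx2 (R : comNzRingType) (A : 'M[R]_2) :
  \det A = A 0 0 * A 1 1 - A 0 1 * A 1 0.
Proof.
rewrite (expand_det_row _ 0) !big_ord_recl big_ord0 addr0 /cofactor !det_mx11 !mxE /=.
rewrite expr0 expr1 mul1r mulN1r mulrN.
by congr (_ * A _ _ - A _ _ * A _ _); apply/val_inj.
Qed.

Lemma sum2 (V : nmodType) (F : 'I_2 -> V) : \sum_i F i = F 0 + F 1.
Proof. by rewrite !big_ord_recl big_ord0 addr0; congr (_ + F _); apply/val_inj. Qed.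

Lemma ord2P (i : 'I_2) : i = 0 \/ i = 1.
Proof. by case: i => [[|[|//]] ?]; [left|right]; apply/val_inj. Qed.

Section WTorsion.
Variables (R : realType) (Mt : weitzenbock R) (r : Mt).
Implicit Types v w : tvec Mt.

Lemma wtorsion_linear (a : R) v v' w : is_tangent r v -> is_tangent r v' ->
  wtorsion r (a *: v + v') w = a *: wtorsion r v w + wtorsion r v' w.
Proof.
move=> tv tv'; rewrite /wtorsion scalerN -opprD scaler_sumr -big_split /=.
congr (- _); apply: eq_bigr => i _; rewrite scaler_sumr -big_split /=.
apply: eq_bigr => j _; rewrite scalerA -scalerDl; congr (_ *: _).
by rewrite wcoord_linear // !mxE mulrDl mulrA.
Qed.

Lemma wtorsion0 w : wtorsion r 0 w = 0.
Proof.
rewrite /wtorsion big1 ?oppr0 // => i _; rewrite big1 // => j _.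
by rewrite wcoord0 mxE mul0r scale0r.
Qed.

Lemma wtorsion_sym v w : wtorsion r w v = - wtorsion r v w.
Proof.
rewrite /wtorsion; congr (- _); rewrite exchange_big /= -sumrN; apply: eq_bigr => i _.
rewrite -sumrN; apply: eq_bigr => j _; rewrite mulrC -scalerN; congr (_ *: _).
apply/funext => f; rewrite -[RHS]/(- _ f) /bracket /germ; case: ifP => _.
  by rewrite opprB.
by rewrite oppr0.
Qed.

Lemma wtorsion_alt v : wtorsion r v v = 0.
Proof.
have /eqP := wtorsion_sym v v; rewrite -addr_eq0 => /eqP H.
apply/funext => f; have := congr1 (fun z : tvec Mt => z f) H.
by rewrite -[_ f]/(_ f + _ f) -[0 f]/(0 : R); lra.
Qed.

Lemma wtorsion_det (a b c d : R) v w : is_tangent r v -> is_tangent r w ->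
  wtorsion r (a *: v + b *: w) (c *: v + d *: w) = (a * d - b * c) *: wtorsion r v w.
Proof.
move=> tv tw; set z := c *: v + _.
have wz u : is_tangent r u -> wtorsion r u z = c *: wtorsion r u v + d *: wtorsion r u w.
  move=> tu; rewrite wtorsion_sym /z wtorsion_linear //; last exact: tangentZ.
  rewrite -[d *: w]addr0 wtorsion_linear //; last exact: tangent0.
  rewrite (wtorsion_sym u v) (wtorsion_sym u w).
  by rewrite wtorsion0 addr0 !scalerN opprD !opprK.
rewrite wtorsion_linear //; last exact: tangentZ.
rewrite -[b *: w]addr0 wtorsion_linear //; last exact: tangent0.
rewrite wtorsion0 addr0 !wz // !wtorsion_alt !scaler0 addr0 add0r (wtorsion_sym v w).
by move: (wtorsion r v w) => T; rewrite !scalerN !scalerA scalerBl.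
Qed.

End WTorsion.

Section SurfacePoint.
Variables (R : realType) (Mt : weitzenbock R) (M : oriented_surface Mt).
Variables (N : M -> tvec Mt) (hN : is_unit_normal N).
Implicit Types (p q : M) (x y v w : tvec M).
Notation iota := (sincl (o := M)).

Lemma sincl_smooth : smooth_map iota.
Proof. by case: (sincl_embedding M). Qed.

(** The identification phi, seen as a map into R^3. *)
Definition scoord p x : 'rV[R]_3 := wcoord (iota p) (dincl p x).
Definition ncoord p : 'rV[R]_3 := wcoord (iota p) (N p).

Lemma dincl_tangent p x : is_tangent p x -> is_tangent (iota p) (dincl p x).
Proof. exact: (dmap_tangent sincl_smooth). Qed.

Lemma smetricE p x y : smetric p x y = dot (scoord p x) (scoord p y).
Proof. by []. Qed.

Lemma scoord_linear p (a : R) x y : is_tangent p x -> is_tangent p y ->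
  scoord p (a *: x + y) = a *: scoord p x + scoord p y.
Proof.
by move=> tx ty; rewrite /scoord /dincl dmap_linear wcoord_linear //; exact: dincl_tangent.
Qed.

Lemma scoord0 p : scoord p 0 = 0.
Proof. by rewrite /scoord /dincl dmap0 wcoord0. Qed.

Lemma scoordZ p (a : R) x : is_tangent p x -> scoord p (a *: x) = a *: scoord p x.
Proof.
by move=> tx; rewrite -[a *: x]addr0 scoord_linear ?scoord0 ?addr0 //; exact: tangent0.
Qed.

Lemma scoordD p x y : is_tangent p x -> is_tangent p y ->
  scoord p (x + y) = scoord p x + scoord p y.
Proof. by move=> tx ty; rewrite -{1}[x]scale1r scoord_linear // scale1r. Qed.

Lemma scoordN p x : is_tangent p x -> scoord p (- x) = - scoord p x.
Proof. by move=> tx; rewrite -scaleN1r scoordZ // scaleN1r. Qed.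

Lemma scoordB p x y : is_tangent p x -> is_tangent p y ->
  scoord p (x - y) = scoord p x - scoord p y.
Proof. by move=> tx ty; rewrite scoordD ?scoordN //; exact: tangentN. Qed.

Lemma scoord_inj p x y : is_tangent p x -> is_tangent p y ->
  scoord p x = scoord p y -> x = y.
Proof.
move=> tx ty xy; apply/eqP; rewrite -subr_eq0; apply/eqP.
have [_ _ imm _] := sincl_embedding M.
apply: (imm p); first exact: tangentB.
rewrite dmapB; apply/eqP; rewrite subr_eq0; apply/eqP.
exact: (wcoord_inj (dincl_tangent tx) (dincl_tangent ty) xy).
Qed.

Lemma scoord_sum p (I : Type) (r : seq I) (F : I -> tvec M) :
  (forall i, is_tangent p (F i)) ->
  scoord p (\sum_(i <- r) F i) = \sum_(i <- r) scoord p (F i).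
Proof.
move=> tF; elim: r => [|i r IH]; first by rewrite !big_nil scoord0.
by rewrite !big_cons scoordD ?IH //; exact: tangent_sum.
Qed.

Lemma scoord_smooth X p i : smooth_field X p -> smooth_at p (fun q => scoord q (X q) 0 i).
Proof.
by move=> sX; apply: (wcoord_smooth sincl_smooth); exact: (along_push sincl_smooth).
Qed.

Lemma ncoord_smooth p i : smooth_at p (fun q => ncoord q 0 i).
Proof. by apply: (wcoord_smooth sincl_smooth); case: hN. Qed.

Lemma normal_tangent p : is_tangent (iota p) (N p).
Proof. by case: hN => sN _ _ _; exact: along_tan (sN p). Qed.

Lemma dot_ncoord p : dot (ncoord p) (ncoord p) = 1.
Proof. by case: hN => _ H _ _; exact: H. Qed.

Lemma dot_ncoord_scoord p x : is_tangent p x -> dot (ncoord p) (scoord p x) = 0.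
Proof. by case: hN => _ _ H _; exact: H. Qed.

(** An orthogonal matrix when e is orthonormal; its determinant carries the
    orientation. *)
Definition frame_mx p (e : 'I_2 -> tvec M) : 'M[R]_(1 + 2) :=
  col_mx (ncoord p) (\matrix_i scoord p (e i)).

Lemma frame_mxT p e : Defs.orthonormal p e -> frame_mx p e *m (frame_mx p e)^T = 1%:M.
Proof.
move=> [te oe]; rewrite /frame_mx tr_col_mx mul_col_row.
have -> : ncoord p *m (ncoord p)^T = 1%:M by rewrite dot_mulmx dot_ncoord.
have nE i : dot (ncoord p) (scoord p (e i)) = 0 by exact: dot_ncoord_scoord.
have -> : ncoord p *m (\matrix_i scoord p (e i))^T = 0.
  apply/matrixP => i j; rewrite !ord1 mxE [RHS]mxE -[RHS](nE j).
  by apply: eq_bigr => k _; rewrite !mxE.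
have -> : (\matrix_i scoord p (e i)) *m (ncoord p)^T = 0.
  apply/matrixP => i j; rewrite !ord1 mxE [RHS]mxE -[RHS](nE i) dotC.
  by apply: eq_bigr => k _; rewrite !mxE.
have -> : (\matrix_i scoord p (e i)) *m (\matrix_i scoord p (e i))^T = 1%:M.
  apply/matrixP => i j; rewrite mxE [RHS]mxE -oe.
  by apply: eq_bigr => k _; rewrite !mxE.
by rewrite -scalar_mx_block.
Qed.

Lemma perp_eq0 p e (y : 'rV[R]_3) : Defs.orthonormal p e ->
  dot y (ncoord p) = 0 -> (forall i, dot y (scoord p (e i)) = 0) -> y = 0.
Proof.
move=> oe yn ye; rewrite -[y]mulmx1 -(mulmx1C (frame_mxT oe)) mulmxA.
rewrite [X in X *m _](_ : _ = 0) ?mul0mx // /frame_mx tr_col_mx mul_mx_row.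
rewrite dot_mulmx yn raddf0 [X in row_mx _ X](_ : _ = 0) ?row_mx0 //.
apply/matrixP => i j; rewrite !ord1 mxE [RHS]mxE -[RHS](ye j).
by apply: eq_bigr => k _; rewrite !mxE.
Qed.

Section Orthonormal.
Variables (p : M) (e : 'I_2 -> tvec M) (oe : Defs.orthonormal p e).

Lemma frame_tangent i : is_tangent p (e i). Proof. by case: oe. Qed.

Lemma frame_dot i j : dot (scoord p (e i)) (scoord p (e j)) = (i == j)%:R.
Proof. by case: oe => _; apply. Qed.

Lemma comb_tangent (a : 'I_2 -> R) : is_tangent p (\sum_i a i *: e i).
Proof. by apply: tangent_sum => i _; apply/tangentZ/frame_tangent. Qed.

Lemma scoord_comb (a : 'I_2 -> R) :
  scoord p (\sum_i a i *: e i) = \sum_i a i *: scoord p (e i).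
Proof.
rewrite scoord_sum => [|i]; last exact/tangentZ/frame_tangent.
by apply: eq_bigr => i _; rewrite scoordZ //; exact: frame_tangent.
Qed.

Lemma dot_comb (a : 'I_2 -> R) j : dot (\sum_i a i *: scoord p (e i)) (scoord p (e j)) = a j.
Proof.
rewrite dot_suml (bigD1 j) //= big1 => [|i ij]; rewrite dotZl frame_dot.
  by rewrite eqxx mulr1 addr0.
by rewrite (negbTE ij) mulr0.
Qed.

(** Vectors of R^3 orthogonal to the normal come from tangent vectors. *)
Lemma perp_expand (y : 'rV[R]_3) : dot y (ncoord p) = 0 ->
  y = \sum_i dot y (scoord p (e i)) *: scoord p (e i).
Proof.
move=> yn; apply/eqP; rewrite -subr_eq0; apply/eqP; apply: (perp_eq0 oe).
  rewrite dotDl yn dotNl dot_suml big1 ?subr0 // => i _.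
  by rewrite dotZl (dotC (scoord p _)) dot_ncoord_scoord ?mulr0 //; exact: frame_tangent.
by move=> i; rewrite dotDl dotNl (dot_comb (fun i => dot y (scoord p (e i)))) subrr.
Qed.

Lemma tangent_expand x : is_tangent p x ->
  x = \sum_i dot (scoord p x) (scoord p (e i)) *: e i.
Proof.
move=> tx; apply: (scoord_inj tx); first exact: comb_tangent.
by rewrite scoord_comb; apply: perp_expand; rewrite dotC dot_ncoord_scoord.
Qed.

Lemma dot_expand (y : 'rV[R]_3) x : is_tangent p x ->
  dot y (scoord p x) = \sum_i dot (scoord p x) (scoord p (e i)) * dot y (scoord p (e i)).
Proof.
move=> tx; rewrite {1}(tangent_expand tx) scoord_comb dotC dot_suml.
by apply: eq_bigr => i _; rewrite dotZl (dotC y).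
Qed.

Lemma tangent_comp_ext x y : is_tangent p x -> is_tangent p y ->
  (forall i, dot (scoord p x) (scoord p (e i)) = dot (scoord p y) (scoord p (e i))) -> x = y.
Proof.
move=> tx ty xy; rewrite (tangent_expand tx) (tangent_expand ty).
by apply: eq_bigr => i _; rewrite xy.
Qed.

Lemma orthonormal_basis : is_basis p e.
Proof.
apply: basis_of_free => [i|a a0]; first exact: frame_tangent.
apply/rowP => j; rewrite -(dot_comb (fun i => a 0 i) j) -scoord_comb a0 scoord0 dot0l.
by rewrite mxE.
Qed.

Lemma frame_coord x i : is_tangent p x ->
  Defs.coord e x 0 i = dot (scoord p x) (scoord p (e i)).
Proof.
move=> tx; rewrite {1}(tangent_expand tx).
exact: (coordE (fun i => dot (scoord p x) (scoord p (e i))) i orthonormal_basis).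
Qed.

Lemma tangentialE z : is_tangent (iota p) z ->
  tangential p z = \sum_i dot (wcoord (iota p) z) (scoord p (e i)) *: e i.
Proof.
move=> tz; set v := \sum_i _; have tv : is_tangent p v by exact: comb_tangent.
have H w u : is_tangent p w -> wmetric (iota p) (z - dincl p w) (dincl p u) =
    dot (wcoord (iota p) z) (scoord p u) - dot (scoord p w) (scoord p u).
  move=> tw; rewrite /wmetric -/(dot _ _) wcoordB ?dotDl ?dotNl //.
  exact: dincl_tangent.
apply: xget_unique => [|w [tw wP]].
  split=> // u tu; rewrite H // !(dot_expand _ tu) -sumrB big1 // => i _.
  rewrite /v scoord_comb (dot_comb (fun i => dot (wcoord (iota p) z) (scoord p (e i)))).
  by rewrite subrr.
apply: tangent_comp_ext => // i.
rewrite /v scoord_comb (dot_comb (fun i => dot (wcoord (iota p) z) (scoord p (e i)))).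
by have := wP (e i) (frame_tangent i); rewrite H // => /eqP; rewrite subr_eq0 => /eqP.
Qed.

Lemma tangential_tangent z : is_tangent (iota p) z -> is_tangent p (tangential p z).
Proof. by move=> /tangentialE ->; exact: comb_tangent. Qed.

Lemma tangential_comp z i : is_tangent (iota p) z ->
  dot (scoord p (tangential p z)) (scoord p (e i)) = dot (wcoord (iota p) z) (scoord p (e i)).
Proof.
move=> /tangentialE ->; rewrite scoord_comb.
exact: (dot_comb (fun i => dot (wcoord (iota p) z) (scoord p (e i)))).
Qed.

Lemma sharpE (alpha : tvec M -> R) :
  (forall a : 'I_2 -> R, alpha (\sum_i a i *: e i) = \sum_i a i * alpha (e i)) ->
  sharp p alpha = \sum_i alpha (e i) *: e i.
Proof.
move=> la; apply: xget_unique => [|w [tw wP]].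
  split=> [|u tu]; first exact: comb_tangent.
  rewrite smetricE (dot_expand _ tu) [in RHS](tangent_expand tu) la.
  by apply: eq_bigr => i _; rewrite scoord_comb dot_comb.
rewrite (tangent_expand tw); apply: eq_bigr => i _.
by rewrite -wP -?smetricE //; exact: frame_tangent.
Qed.

Lemma gradE (f : M -> R) : grad f p = \sum_i e i f *: e i.
Proof.
rewrite /grad sharpE // => a; rewrite fct_sumE.
by apply: eq_bigr => i _.
Qed.

End Orthonormal.

Lemma spos_det p e : (forall i, is_tangent p (e i)) -> spos p e <-> 0 < \det (frame_mx p e).
Proof.
move=> te; have [_ _ _ H] := hN; rewrite H // /woriented.
have -> : \matrix_(i, j) wcoord (iota p)
   [:: N p; dincl p (e 0); dincl p (e 1)]`_(i : 'I_3) 0 j = frame_mx p e.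
  apply/matrixP => i j; rewrite [LHS]mxE /frame_mx mxE.
  case: splitP => k ->; first by rewrite ord1.
  by rewrite mxE; have [->|->] := ord2P k.
split=> [[]//|dp]; split=> // i.
case: i => -[|[|[|//]]] ? /=; [exact: normal_tangent|exact: dincl_tangent|].
exact: dincl_tangent.
Qed.

Lemma frame_mx_comb p e f (A : 'M[R]_2) : Defs.orthonormal p e ->
  (forall i, f i = \sum_j A i j *: e j) ->
  \det (frame_mx p f) = \det A * \det (frame_mx p e).
Proof.
move=> oe fA; have -> : frame_mx p f = block_mx 1%:M 0 0 A *m frame_mx p e.
  rewrite /frame_mx mul_block_col mul1mx !mul0mx add0r addr0; congr col_mx.
  apply/row_matrixP => i; rewrite rowK fA (scoord_comb oe) row_mul.
  apply/rowP => k; rewrite summxE mxE; apply: eq_bigr => j _.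
  by rewrite !mxE.
by rewrite det_mulmx det_ublock det1 mul1r.
Qed.

Lemma det_frame_mx p e : Defs.orthonormal p e -> \det (frame_mx p e) ^+ 2 = 1.
Proof. by move=> /frame_mxT /(congr1 determinant); rewrite det_mulmx det_tr det1 expr2. Qed.

(** The matrix from e to f is orthogonal with positive determinant, hence
    (d - a)^2 + (c + b)^2 = 2 - 2 det = 0 for its rows (a, b) and (c, d). *)
Lemma rotation p e f : Defs.orthonormal p e -> Defs.orthonormal p f -> spos p e -> spos p f ->
  exists c s : R, [/\ c ^+ 2 + s ^+ 2 = 1, f 0 = c *: e 0 + s *: e 1
    & f 1 = - s *: e 0 + c *: e 1].
Proof.
move=> oe of_ /(spos_det (frame_tangent oe)) pe /(spos_det (frame_tangent of_)).
pose A := \matrix_(i, j) dot (scoord p (f i)) (scoord p (e j)).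
have fA i : f i = \sum_j A i j *: e j.
  rewrite {1}(tangent_expand oe (frame_tangent of_ i)).
  by apply: eq_bigr => j _; rewrite mxE.
rewrite (frame_mx_comb oe fA) pmulr_lgt0 // det_mx2 => dA.
have dotf i j : A i 0 * A j 0 + A i 1 * A j 1 = (i == j)%:R.
  rewrite -(frame_dot of_) (dot_expand oe _ (frame_tangent of_ j)) sum2 !mxE.
  by rewrite mulrC [X in _ + X]mulrC.
have d00 := dotf 0 0; have d01 := dotf 0 1; have d11 := dotf 1 1.
rewrite /= in d00 d01 d11.
move: (fA 0) (fA 1); rewrite !sum2.
move: dA d00 d01 d11; set a := A 0 0; set b := A 0 1; set c := A 1 0; set d := A 1 1.
move=> dA d00 d01 d11 f0 f1.
have : (a * d - b * c) ^+ 2 = 1.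
  have -> : (a * d - b * c) ^+ 2 = (a * a + b * b) * (c * c + d * d) - (a * c + b * d) ^+ 2.
    by ring.
  by rewrite d00 d01 d11; ring.
move=> /eqP; rewrite sqrf_eq1 => /orP[/eqP D1|/eqP D1]; last first.
  by move: dA; rewrite D1 oppr_gt0 ltr10.
have : (d - a) ^+ 2 + (c + b) ^+ 2 = 0.
  have -> : (d - a) ^+ 2 + (c + b) ^+ 2 =
     (a * a + b * b) + (c * c + d * d) - (a * d - b * c) - (a * d - b * c) by ring.
  by rewrite d00 d11 D1 /=; ring.
move=> /eqP; rewrite paddr_eq0 ?sqr_ge0 // !sqrf_eq0 subr_eq0 addr_eq0 => /andP[/eqP da /eqP cb].
exists a, b; split; [by rewrite !expr2|exact: f0|by rewrite f1 da cb].
Qed.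

Lemma JrotE p e x : Defs.orthonormal p e -> spos p e -> is_tangent p x ->
  Jrot p x = dot (scoord p x) (scoord p (e 0)) *: e 1 - dot (scoord p x) (scoord p (e 1)) *: e 0.
Proof.
move=> oe pe tx; apply: xget_unique; first by exists e.
move=> _ [f [pf of_ ->]]; rewrite !smetricE.
have [c [s [cs f0 f1]]] := rotation oe of_ pe pf.
have te := frame_tangent oe.
rewrite f0 f1 !scoord_linear ?scoordZ //; try exact: tangentZ.
rewrite !dotDr !dotZr.
set a := dot _ (scoord p (e 0)); set b := dot _ (scoord p (e 1)).
apply/funext => h; rewrite -[LHS]/((_ * (_ * _ + _ * _)) - _ * (_ * _ + _ * _)).
rewrite -[RHS]/(_ * _ - _ * _) -[RHS]mul1r -cs /=; ring.
Qed.

Lemma tauE p x y : is_tangent p x -> is_tangent p y ->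
  tau N p x y = dot (ncoord p) (wcoord (iota p) (wtorsion (iota p) (dincl p x) (dincl p y))).
Proof. by move=> tx ty; rewrite /tau torsion_wconn //; exact: dincl_tangent. Qed.

End SurfacePoint.

(** * Local orthonormal frames *)

Section VectorDerivative.
Variables (R : realType) (n k : nat) (M : manifold R n).
Implicit Types (p q : M) (x : tvec M) (u v : M -> 'rV[R]_k).

Definition vderiv x u : 'rV[R]_k := \row_i x (fun q => u q 0 i).

Definition vsmooth p u := forall i, smooth_at p (fun q => u q 0 i).

Lemma vderiv_dot p x u v : is_tangent p x -> vsmooth p u -> vsmooth p v ->
  x (fun q => dot (u q) (v q)) = dot (vderiv x u) (v p) + dot (u p) (vderiv x v).
Proof.
move=> tx su sv; rewrite (tv_sum _ tx); last by move=> i _; apply: smoothM.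
rewrite -big_split; apply: eq_bigr => i _.
by rewrite (tv_mul tx) // !mxE.
Qed.

Lemma smooth_dot p u v : vsmooth p u -> vsmooth p v -> smooth_at p (fun q => dot (u q) (v q)).
Proof. by move=> su sv; apply: smooth_sum => i _; apply: smoothM. Qed.

Lemma vderiv_comb m (a : 'I_m -> R) (x : 'I_m -> tvec M) u :
  vderiv (\sum_i a i *: x i) u = \sum_i a i *: vderiv (x i) u.
Proof.
by apply/rowP => j; rewrite mxE fct_sumE summxE; apply: eq_bigr => i _; rewrite !mxE.
Qed.

Lemma vderiv_smooth p (X : M -> tvec M) u : smooth_field X p -> vsmooth p u ->
  vsmooth p (fun q => vderiv (X q) u).
Proof.
move=> sX su i; apply: (@smooth_ext _ _ _ _ (fun q => X q (fun r => u r 0 i))).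
  by apply: nearW => q; rewrite mxE.
by apply: (along_smooth sX); exact: su.
Qed.

End VectorDerivative.

Section LocalFrame.
Variables (R : realType) (Mt : weitzenbock R) (M : oriented_surface Mt).
Variables (N : M -> tvec Mt) (hN : is_unit_normal N).
Variables (D : M -> tvec M -> (M -> tvec Mt) -> tvec Mt).
Hypothesis hD : is_pullback (wconn (w := Mt)) (sincl (o := M)) D.
Hypothesis bracket_tangent : forall p (X Y : M -> tvec M),
  smooth_field X p -> smooth_field Y p -> is_tangent p (bracket X Y p).
Implicit Types (p q : M) (x y v w : tvec M) (X Y : M -> tvec M).
Notation iota := (sincl (o := M)).
Notation n := (ncoord N).
Notation sc := (scoord (M := M)).

Lemma vsmooth_n p : vsmooth p n.
Proof. by move=> i; exact: ncoord_smooth. Qed.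

Lemma vsmooth_field X p : smooth_field X p -> vsmooth p (fun q => sc q (X q)).
Proof. by move=> sX i; exact: scoord_smooth. Qed.

Lemma dincl_along X p : smooth_field X p -> smooth_along iota (fun q => dincl q (X q)) p.
Proof. by move=> sX; exact: (along_push (@sincl_smooth _ _ M) sX). Qed.

Lemma D_tangent p x X : is_tangent p x -> smooth_field X p ->
  is_tangent (iota p) (D p x (fun q => dincl q (X q))).
Proof. by move=> tx sX; apply: (conn_tan hD.1 tx); exact: dincl_along. Qed.

Lemma wcoord_D p x X : is_tangent p x -> smooth_field X p ->
  wcoord (iota p) (D p x (fun q => dincl q (X q))) = vderiv x (fun q => sc q (X q)).
Proof.
move=> tx sX; apply/rowP => i; rewrite mxE (wcoord_pullback (@sincl_smooth _ _ M) _ hD tx) //.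
exact: dincl_along.
Qed.

Lemma dot_n_vderiv p x X : is_tangent p x -> smooth_field X p ->
  dot (n p) (vderiv x (fun q => sc q (X q))) = - dot (vderiv x n) (sc p (X p)).
Proof.
move=> tx sX.
have := vderiv_dot tx (vsmooth_n p) (vsmooth_field sX).
have -> : x (fun q => dot (n q) (sc q (X q))) = 0.
  rewrite -(tv_cst 0 tx); apply: (tv_near tx); apply: filterS sX => q [tq _].
  exact: dot_ncoord_scoord.
by move/esym/eqP; rewrite addrC addr_eq0 => /eqP.
Qed.

Lemma dot_vderiv_n p x : is_tangent p x -> dot (vderiv x n) (n p) = 0.
Proof.
move=> tx; have := vderiv_dot tx (vsmooth_n p) (vsmooth_n p).
have -> : x (fun q => dot (n q) (n q)) = 0.
  rewrite -(tv_cst 1 tx); apply: (tv_near tx); apply: nearW => q.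
  exact: dot_ncoord.
by rewrite (dotC (n p)); lra.
Qed.

(** Here [wtorsion], a combination of brackets of frame fields, is seen to be a
    tangent vector: the other terms of the structure equation are, the bracket
    of fields on the surface by hypothesis. *)
Lemma structure_coord X Y p : smooth_field X p -> smooth_field Y p ->
  let T := wtorsion (iota p) (dincl p (X p)) (dincl p (Y p)) in
  is_tangent (iota p) T /\
  wcoord (iota p) T = vderiv (X p) (fun q => sc q (Y q)) -
    vderiv (Y p) (fun q => sc q (X q)) - sc p (bracket X Y p).
Proof.
move=> sX sY T; have := structure_equation (@sincl_smooth _ _ M) sX sY.
rewrite /= -/(dincl p _) -/T -/(dincl p (bracket X Y p)) => <-.
have tb := dincl_tangent (bracket_tangent sX sY).
set S := \sum_i _.
have tS : is_tangent (iota p) S.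
  by apply: tangent_sum => i _; apply: tangentZ; exact: wframe_tangent.
split; first exact: tangentB.
rewrite wcoordB //; congr (_ - _); apply/rowP => i.
by rewrite /S (wcoordE _ (fun i => _ - _)) !mxE.
Qed.

Lemma lof_near p E : local_orthonormal_frame (M := M) p E ->
  \forall q \near p, local_orthonormal_frame q E.
Proof.
move=> [sE oE]; have sE' : \forall q \near p, forall i, smooth_field (E i) q.
  by apply: filter_forall => i; exact: (along_near (sE i)).
by apply: filterS2 sE' (near_join oE) => q.
Qed.

Section AtPoint.
Variables (p : M) (E : 'I_2 -> M -> tvec M).
Hypothesis lE : local_orthonormal_frame p E.
Notation e i := (sc p (E i p)).

Lemma lof_on : Defs.orthonormal p (fun i => E i p).
Proof. exact: nbhs_singleton lE.2. Qed.

Lemma lof_tan i : is_tangent p (E i p).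
Proof. exact: (frame_tangent lof_on i). Qed.

Lemma lof_field i : smooth_field (E i) p.
Proof. exact: lE.1. Qed.

(** A field through a given tangent vector, needed because torsion and the
    Weingarten map are characterized by fields. *)
Definition field_ext x : M -> tvec M := fun q => \sum_i dot (sc p x) (e i) *: E i q.

Lemma field_ext_smooth x : smooth_field (field_ext x) p.
Proof.
apply: (@along_sum _ _ _ M M id _ _ (fun i q => dot (sc p x) (e i) *: E i q)) => i.
apply: (@alongZ _ _ _ M M id (fun=> dot (sc p x) (e i))); first exact: smooth_cst.
exact: lof_field.
Qed.

Lemma field_extE x : is_tangent p x -> field_ext x p = x.
Proof. by move=> tx; rewrite [RHS](tangent_expand hN lof_on tx). Qed.

(** The coefficient of E_j in W E_i. *)
Definition second_form i j q := - dot (vderiv (E i q) n) (sc q (E j q)).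

Lemma weingartenE x : is_tangent p x ->
  weingarten D N p x = \sum_j - dot (vderiv x n) (e j) *: E j p.
Proof.
move=> tx; set v := \sum_j _; have tv : is_tangent p v by exact: (comb_tangent lof_on).
have H Y : smooth_field Y p -> 
    wmetric (iota p) (N p) (D p x (fun q => dincl q (Y q))) = - dot (vderiv x n) (sc p (Y p)).
  by move=> sY; rewrite -(dot_n_vderiv tx sY) -(wcoord_D tx sY).
apply: xget_unique => [|w [tw wP]].
  split=> // Y sY; rewrite smetricE H //.
  have tY : is_tangent p (Y p) := along_tan sY.
  rewrite !(dot_expand hN lof_on _ tY) -sumrN; apply: eq_bigr => i _.
  rewrite /v (scoord_comb lof_on) (dot_comb lof_on (fun j => - dot (vderiv x n) (e j))).
  by rewrite mulrN.
apply: (tangent_comp_ext hN lof_on) => // i.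
rewrite /v (scoord_comb lof_on) (dot_comb lof_on (fun j => - dot (vderiv x n) (e j))).
by have := wP _ (lof_field i); rewrite smetricE H //; exact: lof_field.
Qed.

Lemma weingarten_tangent x : is_tangent p x -> is_tangent p (weingarten D N p x).
Proof. by move=> /weingartenE ->; exact: (comb_tangent lof_on). Qed.

Lemma weingarten_comp x j : is_tangent p x ->
  dot (sc p (weingarten D N p x)) (e j) = - dot (vderiv x n) (e j).
Proof.
move=> /weingartenE ->; rewrite (scoord_comb lof_on).
exact: (dot_comb lof_on (fun j => - dot (vderiv x n) (e j))).
Qed.

Lemma mean_curvE : mean_curv D N p = second_form 0 0 p + second_form 1 1 p.
Proof.
rewrite /mean_curv (traceE (orthonormal_basis lof_on)).
- rewrite sum2 !(frame_coord hN lof_on) ?weingarten_comp //;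
    try exact: lof_tan; exact/weingarten_tangent/lof_tan.
- exact: weingarten_tangent.
- move=> a; have tc := comb_tangent lof_on a.
  have tW i := weingarten_tangent (lof_tan i).
  apply: (tangent_comp_ext hN lof_on); first exact: weingarten_tangent.
    by apply: tangent_sum => i _; exact: tangentZ.
  move=> j; rewrite weingarten_comp // vderiv_comb dot_suml -sumrN.
  rewrite scoord_sum => [|i]; last exact: tangentZ.
  rewrite dot_suml; apply: eq_bigr => i _.
  by rewrite scoordZ // !dotZl weingarten_comp ?mulrN //; exact: lof_tan.
Qed.

Lemma projected_comp x X j : is_tangent p x -> smooth_field X p ->
  dot (sc p (projected_conn D p x X)) (e j) = dot (vderiv x (fun q => sc q (X q))) (e j).
Proof.
by move=> tx sX; rewrite (tangential_comp hN lof_on) ?wcoord_D //; exact: D_tangent.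
Qed.

Lemma projected_tangent x X : is_tangent p x -> smooth_field X p ->
  is_tangent p (projected_conn D p x X).
Proof. by move=> tx sX; apply: (tangential_tangent hN lof_on); exact: D_tangent. Qed.

Definition dtorsion x y := wtorsion (iota p) (dincl p x) (dincl p y).

Lemma dtorsion_tangent x y : is_tangent p x -> is_tangent p y ->
  is_tangent (iota p) (dtorsion x y).
Proof.
move=> tx ty; have := (structure_coord (field_ext_smooth x) (field_ext_smooth y)).1.
by rewrite !field_extE.
Qed.

(** The right-hand side depends on x and y only through their values, which is
    the tensoriality that makes the torsion well defined. *)
Lemma torsion_projected x y : is_tangent p x -> is_tangent p y ->
  torsion (projected_conn D) p x y = tangential p (dtorsion x y).
Proof.
move=> tx ty.
have H X Y : smooth_field X p -> smooth_field Y p ->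
    torsion_field (projected_conn D) X Y p = tangential p (dtorsion (X p) (Y p)).
  move=> sX sY; have tX : is_tangent p (X p) := along_tan sX.
  have tY : is_tangent p (Y p) := along_tan sY.
  have tXY := projected_tangent tX sY; have tYX := projected_tangent tY sX.
  have tb := bracket_tangent sX sY.
  have [tT TE] := structure_coord sX sY.
  apply: (tangent_comp_ext hN lof_on).
  - by apply: tangentB => //; exact: tangentB.
  - exact: (tangential_tangent hN lof_on).
  - move=> j; rewrite (tangential_comp hN lof_on) // TE scoordB ?scoordB //; last exact: tangentB.
    by rewrite !(dotDl, dotNl) !projected_comp.
apply: xget_unique => [|t [X [Y [sX sY <- <- ->]]]]; last exact: H.
exists (field_ext x), (field_ext y); split; try exact: field_ext_smooth; try exact: field_extE.
by rewrite H ?field_extE //; exact: field_ext_smooth.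
Qed.

(** The components of T(E_0, E_1). *)
Definition ctorsion j := dot (wcoord (iota p) (dtorsion (E 0 p) (E 1 p))) (e j).

Lemma dtorsion_comb (a b c d : R) x y : is_tangent p x -> is_tangent p y ->
  dtorsion (a *: x + b *: y) (c *: x + d *: y) = (a * d - b * c) *: dtorsion x y.
Proof.
move=> tx ty; rewrite /dtorsion /dincl !dmapD !dmapZ wtorsion_det //; exact: dincl_tangent.
Qed.

Lemma torsion_comb (a b c d : R) :
  torsion (projected_conn D) p (a *: E 0 p + b *: E 1 p) (c *: E 0 p + d *: E 1 p) =
  (a * d - b * c) *: (ctorsion 0 *: E 0 p + ctorsion 1 *: E 1 p).
Proof.
have t0 := lof_tan 0; have t1 := lof_tan 1.
rewrite torsion_projected; try by apply: tangentD; exact: tangentZ.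
rewrite dtorsion_comb // (tangentialE hN lof_on); last exact/tangentZ/dtorsion_tangent.
rewrite wcoordZ; last exact: dtorsion_tangent.
by rewrite sum2 !dotZl scalerDr !scalerA.
Qed.

Lemma tr_torsionE (a b : R) :
  tr_torsion D p (a *: E 0 p + b *: E 1 p) = a * ctorsion 1 - b * ctorsion 0.
Proof.
have t0 := lof_tan 0; have t1 := lof_tan 1.
set t := ctorsion 0 *: E 0 p + ctorsion 1 *: E 1 p.
have tt : is_tangent p t by apply: tangentD; exact: tangentZ.
have Tcd c d : torsion (projected_conn D) p (a *: E 0 p + b *: E 1 p) (c *: E 0 p + d *: E 1 p) =
    (a * d - b * c) *: t by exact: torsion_comb.
have T0 : torsion (projected_conn D) p (a *: E 0 p + b *: E 1 p) (E 0 p) = - b *: t.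
  by have := Tcd 1 0; rewrite scale1r scale0r addr0 => ->; congr (_ *: _); ring.
have T1 : torsion (projected_conn D) p (a *: E 0 p + b *: E 1 p) (E 1 p) = a *: t.
  by have := Tcd 0 1; rewrite scale1r scale0r add0r => ->; congr (_ *: _); ring.
have tc j : dot (sc p t) (e j) = ctorsion j.
  have -> : t = \sum_j ctorsion j *: E j p by rewrite sum2.
  by rewrite (scoord_comb lof_on) (dot_comb lof_on).
have txy : is_tangent p (a *: E 0 p + b *: E 1 p) by apply: tangentD; exact: tangentZ.
rewrite /tr_torsion (traceE (orthonormal_basis lof_on)).
- rewrite sum2 T0 T1 !(frame_coord hN lof_on); try exact: tangentZ.
  by rewrite !scoordZ // !dotZl !tc; ring.
- move=> y ty; rewrite torsion_projected //; apply: (tangential_tangent hN lof_on).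
  exact: dtorsion_tangent.
- move=> f; rewrite !sum2 Tcd T0 T1 !scalerA -scalerDl; congr (_ *: _); ring.
Qed.

(** In dimension two the torsion is the single vector t = T(E_0, E_1), and the
    trace form is dual to - J t. *)
Lemma sharp_torsionE :
  sharp p (tr_torsion D p) = ctorsion 1 *: E 0 p - ctorsion 0 *: E 1 p.
Proof.
have T0 : tr_torsion D p (E 0 p) = ctorsion 1.
  by have := tr_torsionE 1 0; rewrite scale1r scale0r addr0 => ->; ring.
have T1 : tr_torsion D p (E 1 p) = - ctorsion 0.
  by have := tr_torsionE 0 1; rewrite scale1r scale0r add0r => ->; ring.
rewrite (sharpE hN lof_on) => [|a]; first by rewrite sum2 T0 T1 scaleNr.
by rewrite !sum2 tr_torsionE T0 T1; ring.
Qed.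

Lemma dot_n_torsion :
  dot (n p) (wcoord (iota p) (dtorsion (E 0 p) (E 1 p))) = second_form 0 1 p - second_form 1 0 p.
Proof.
have sE i := lof_field i; have tE i := lof_tan i.
rewrite (structure_coord (sE 0) (sE 1)).2 !(dotDr, dotNr) !dot_n_vderiv //.
rewrite dot_ncoord_scoord //; last exact: bracket_tangent.
by rewrite subr0.
Qed.

Lemma star_tauE : spos p (fun i => E i p) -> star_tau N p = second_form 0 1 p - second_form 1 0 p.
Proof.
move=> pE; rewrite -dot_n_torsion; have tE i := lof_tan i.
apply: xget_unique => [|_ [f [pf of_ ->]]].
  exists (fun i => E i p); split=> //; first exact: lof_on.
  by rewrite tauE.
have [c [s [cs f0 f1]]] := rotation hN lof_on of_ pE pf.
rewrite tauE //; try exact: (frame_tangent of_).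
rewrite f0 f1 -/(dtorsion _ _) dtorsion_comb // wcoordZ ?dotZr; last exact: dtorsion_tangent.
have -> : c * c - s * - s = c ^+ 2 + s ^+ 2 by ring.
by rewrite cs mul1r.
Qed.

(** The coefficients of the projected connection, the E_l component of the
    derivative of E_i along E_k. *)
Definition cconn k i l := dot (vderiv (E k p) (fun q => sc q (E i q))) (e l).

Definition dsecond_form k i j := E k p (second_form i j).

(** Differentiate the constant inner products of the frame. *)
Lemma cconn_anti k i l : cconn k i l = - cconn k l i.
Proof.
have := vderiv_dot (lof_tan k) (vsmooth_field (lof_field i)) (vsmooth_field (lof_field l)).
rewrite (_ : E k p _ = 0); last first.
  rewrite -(tv_cst (i == l)%:R (lof_tan k)); apply: (tv_near (lof_tan k)).
  by apply: filterS lE.2 => q oq; rewrite (frame_dot oq).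
rewrite (dotC (e i)) -/(cconn k i l) -/(cconn k l i); lra.
Qed.

Lemma projected_cconn i l : dot (sc p (projected_conn D p (E i p) (E i))) (e l) = cconn i i l.
Proof. by rewrite projected_comp //; [exact: lof_tan|exact: lof_field]. Qed.

Definition hess k i : 'rV[R]_3 := vderiv (E k p) (fun q => vderiv (E i q) n).

Lemma vsmooth_dn i : vsmooth p (fun q => vderiv (E i q) n).
Proof. by apply: vderiv_smooth; [exact: lof_field|exact: vsmooth_n]. Qed.

Lemma second_form_smooth i j : smooth_at p (second_form i j).
Proof.
apply: smoothN; apply: smooth_dot; first exact: vsmooth_dn.
exact: (vsmooth_field (lof_field j)).
Qed.

Lemma dn_expand x : is_tangent p x ->
  vderiv x n = \sum_l dot (vderiv x n) (e l) *: e l.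
Proof. by move=> tx; apply: (perp_expand hN lof_on); exact: dot_vderiv_n. Qed.

Lemma dsecond_formE k i j :
  dsecond_form k i j = - dot (hess k i) (e j) + \sum_l second_form i l p * cconn k j l.
Proof.
have tk := lof_tan k; have sj := vsmooth_field (lof_field j).
rewrite /dsecond_form {1}/second_form (tv_opp tk); last exact: smooth_dot (vsmooth_dn i) sj.
rewrite (vderiv_dot tk (vsmooth_dn i) sj) opprD; congr (_ + _).
rewrite (dn_expand (lof_tan i)) dot_suml -sumrN; apply: eq_bigr => l _.
by rewrite dotZl (dotC (e l)) /second_form mulNr.
Qed.

(** Both sides are the E_j component of [E_0, E_1] applied to n, the right-hand
    one with the bracket expanded in the frame by the definition of torsion. *)
Lemma codazzi j : dot (hess 0 1) (e j) - dot (hess 1 0) (e j) =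
  - \sum_l (cconn 0 1 l - cconn 1 0 l - ctorsion l) * second_form l j p.
Proof.
have sE i := lof_field i.
have tb := bracket_tangent (sE 0) (sE 1).
have c l : dot (sc p (bracket (E 0) (E 1) p)) (e l) = cconn 0 1 l - cconn 1 0 l - ctorsion l.
  rewrite /ctorsion (structure_coord (sE 0) (sE 1)).2 !(dotDl, dotNl) /cconn; ring.
have : vderiv (bracket (E 0) (E 1) p) n = hess 0 1 - hess 1 0.
  apply/rowP => k; rewrite !mxE /bracket germE; last exact: vsmooth_n.
  by congr (E 0 p _ - E 1 p _); apply/funext => q; rewrite mxE.
rewrite (tangent_expand hN lof_on tb) vderiv_comb => /(congr1 (fun z : 'rV[R]_3 => dot z (e j))).
rewrite dotDl dotNl => <-; rewrite dot_suml -sumrN; apply: eq_bigr => l _.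
by rewrite dotZl c /second_form mulrN opprK.
Qed.

Section Gauss.
Variables (S2 : unit_sphere R) (g : M -> S2) (hg : is_gauss_map N g).
Variables (nS : connection S2) (hnS : is_levi_civita (round_metric (S2 := S2)) nS).
Variables (DS : M -> tvec M -> (M -> tvec S2) -> tvec S2) (hDS : is_pullback nS g DS).

Lemma gauss_smooth : smooth_map g.
Proof.
apply: smooth_into_sphere => q i; apply: smooth_ext (ncoord_smooth hN q i).
by apply: nearW => r; rewrite hg.
Qed.

Lemma ucoord_dmap q x : ucoord (dmap g q x) = vderiv x n.
Proof.
apply/rowP => i; rewrite !mxE dmapE; last exact: upt_smooth.
by congr x; apply/funext => r; rewrite /= hg.
Qed.

Lemma phiE x : is_tangent p x ->
  is_tangent (g p) (phi g p x) /\ ucoord (phi g p x) = sc p x.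
Proof.
move=> tx; have [|w tw wx] := @ucoord_surj _ S2 (g p) (sc p x).
  by rewrite hg dotC dot_ncoord_scoord.
by apply: (@xgetI _ 0 [set w | is_tangent (g p) w /\ ucoord w = sc p x] w).
Qed.

Lemma phi_invE (w : tvec S2) : is_tangent (g p) w ->
  phi_inv g p w = \sum_j dot (ucoord w) (e j) *: E j p.
Proof.
move=> tw; set x := \sum_j _; have tx : is_tangent p x by exact: (comb_tangent lof_on).
have wn : dot (ucoord w) (n p) = 0 by rewrite -[n p]hg dot_upt_ucoord.
have xw : sc p x = ucoord w.
  by rewrite /x (scoord_comb lof_on) -(perp_expand hN lof_on wn).
apply: xget_unique => [|y [ty yw]].
  split=> //; have [tphi phix] := phiE tx.
  by apply: (ucoord_inj tphi tw); rewrite phix.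
have [tphi phiy] := phiE ty.
by apply: (scoord_inj ty tx); rewrite -phiy yw xw.
Qed.

(** The projection onto the sphere disappears in the inner product with the
    tangent vector e_j, and - X(n) is the image of W X. *)
Lemma laplacian_comp (nabla : connection M) (G : 'I_2 -> 'I_2 -> R) :
  (forall i, is_tangent p (nabla p (E i p) (E i))) ->
  (forall i l, dot (sc p (nabla p (E i p) (E i))) (e l) = G i l) ->
  is_tangent (g p) (laplacian g DS nabla E p) /\
  forall j, dot (ucoord (laplacian g DS nabla E p)) (e j) =
    \sum_i (dot (hess i i) (e j) + \sum_l G i l * second_form l j p).
Proof.
move=> tnab nabG; have sg := gauss_smooth.
have sV i : smooth_along g (fun q => dmap g q (E i q)) p.
  by apply: (along_push sg); exact: lof_field.
split.
  apply: tangent_sum => i _; apply: tangentB.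
    by apply: (conn_tan hDS.1) => //; exact: lof_tan.
  by apply: (dmap_tangent sg); exact: tnab.
move=> j; rewrite /laplacian ucoord_sum dot_suml; apply: eq_bigr => i _.
have [z tz zj] : exists2 z, is_tangent (g p) z & ucoord z = e j.
  by apply: ucoord_surj; rewrite hg dotC dot_ncoord_scoord //; exact: lof_tan.
rewrite ucoordB dotDl dotNl ucoord_dmap; congr (_ + _).
  rewrite -zj (sphere_pullback hnS sg hDS (lof_tan i) (sV i) tz); congr (dot _ _).
  apply/rowP => k; rewrite !mxE; congr (E i p _); apply/funext => q.
  by rewrite ucoord_dmap.
rewrite {1}(tangent_expand hN lof_on (tnab i)) vderiv_comb dot_suml -sumrN.
by apply: eq_bigr => l _; rewrite dotZl nabG /second_form mulrN.
Qed.

End Gauss.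

(** In dimension two a metric connection is given by the form
    X |-> <nabla_X E_0, E_1>, which its torsion determines; the forms of the two
    connections, projected minus Levi-Civita, differ by the dual of
    - T(E_0, E_1). *)
Lemma levi_civita_trace (nbar : connection M) :
  is_levi_civita (smetric (M := M)) nbar ->
  (forall i, is_tangent p (nbar p (E i p) (E i))) /\
  forall l, \sum_i dot (sc p (nbar p (E i p) (E i))) (e l) =
    \sum_i cconn i i l - dot (sc p (sharp p (tr_torsion D p))) (e l).
Proof.
move=> [cn tf mc]; have sE i := lof_field i; have tE i := lof_tan i.
have tn i k : is_tangent p (nbar p (E i p) (E k)) by exact: (conn_tan cn (tE i) (sE k)).
split=> // l.
pose G i k l := dot (sc p (nbar p (E i p) (E k))) (e l).
have Ga i k m : G i k m = - G i m k.
  have := mc p (E i p) (E k) (E m) (tE i) (sE k) (sE m).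
  rewrite (_ : E i p _ = 0); last first.
    rewrite -(tv_cst (k == m)%:R (tE i)); apply: (tv_near (tE i)).
    by apply: filterS lE.2 => q oq; rewrite smetricE; exact: (frame_dot oq k m).
  rewrite !smetricE (dotC (e k)) -/(G i k m) -/(G i m k); lra.
have Gt m : G 0 1 m - G 1 0 m = cconn 0 1 m - cconn 1 0 m - ctorsion m.
  have /eqP := tf p (E 0) (E 1) (sE 0) (sE 1); rewrite /torsion_field subr_eq0 => /eqP T0.
  have := congr1 (fun z => dot (sc p z) (e m)) T0.
  rewrite scoordB // dotDl dotNl /G => ->.
  rewrite /ctorsion (structure_coord (sE 0) (sE 1)).2 !(dotDl, dotNl) /cconn; ring.
rewrite !sum2 -!/(G _ _ _) sharp_torsionE.
have -> : ctorsion 1 *: E 0 p - ctorsion 0 *: E 1 p =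
    \sum_i [:: ctorsion 1; - ctorsion 0]`_(i : 'I_2) *: E i p by rewrite sum2 /= scaleNr.
rewrite (scoord_comb lof_on) (dot_comb lof_on (fun i : 'I_2 => [:: ctorsion 1; - ctorsion 0]`_i)).
have := Gt 0; have := Gt 1.
have := Ga 0 0 0; have := Ga 1 1 1; have := Ga 0 1 1; have := Ga 1 0 0.
have := Ga 0 0 1; have := Ga 1 1 0.
have := cconn_anti 0 0 0; have := cconn_anti 1 1 1; have := cconn_anti 0 1 1.
have := cconn_anti 1 0 0; have := cconn_anti 0 0 1; have := cconn_anti 1 1 0.
by have [->|->] := ord2P l; rewrite /=; lra.
Qed.

End AtPoint.
End LocalFrame.

(** * The Laplacians of the Gauss map *)

Section Oriented.
Variables (R : realType) (Mt : weitzenbock R) (M : oriented_surface Mt).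
Variables (N : M -> tvec Mt) (hN : is_unit_normal N).
Variables (D : M -> tvec M -> (M -> tvec Mt) -> tvec Mt).
Hypothesis hD : is_pullback (wconn (w := Mt)) (sincl (o := M)) D.
Variables (nbar : connection M) (hnbar : is_levi_civita (smetric (M := M)) nbar).
Variables (S2 : unit_sphere R) (g : M -> S2) (hg : is_gauss_map N g).
Variables (nS : connection S2) (hnS : is_levi_civita (round_metric (S2 := S2)) nS).
Variables (DS : M -> tvec M -> (M -> tvec S2) -> tvec S2) (hDS : is_pullback nS g DS).
Notation sc := (scoord (M := M)).

Lemma bracket_tangent p (X Y : M -> tvec M) :
  smooth_field X p -> smooth_field Y p -> is_tangent p (bracket X Y p).
Proof.
move=> sX sY; have [cn tf _] := hnbar.
have /eqP := tf p X Y sX sY; rewrite /torsion_field subr_eq0 => /eqP <-.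
have tX : is_tangent p (X p) := along_tan sX.
have tY : is_tangent p (Y p) := along_tan sY.
by apply: tangentB; [exact: (conn_tan cn tX sY)|exact: (conn_tan cn tY sX)].
Qed.

Variables (p : M) (E : 'I_2 -> M -> tvec M).
Hypothesis lE : local_orthonormal_frame p E.
Hypothesis pE : \forall q \near p, spos q (fun i => E i q).

Lemma oriented_Jrot (a b : R) : Jrot p (a *: E 0 p + b *: E 1 p) = a *: E 1 p - b *: E 0 p.
Proof.
have oE := lof_on lE; have tE := lof_tan lE.
rewrite (JrotE hN oE) //; [|exact: nbhs_singleton pE|by apply: tangentD; exact: tangentZ].
pose f (i : 'I_2) := [:: a; b]`_i.
have -> : a *: E 0 p + b *: E 1 p = \sum_i f i *: E i p by rewrite sum2.
by rewrite (scoord_comb oE) !(dot_comb oE f).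
Qed.

Lemma grad_mean_curv : grad (mean_curv D N) p =
  (dsecond_form N p E 0 0 0 + dsecond_form N p E 0 1 1) *: E 0 p +
  (dsecond_form N p E 1 0 0 + dsecond_form N p E 1 1 1) *: E 1 p.
Proof.
rewrite (gradE hN (lof_on lE)) sum2.
have H : {near p, mean_curv D N =1 fun q => second_form N E 0 0 q + second_form N E 1 1 q}.
  by apply: filterS (lof_near lE) => q lEq; exact: mean_curvE.
have HE k : E k p (mean_curv D N) = dsecond_form N p E k 0 0 + dsecond_form N p E k 1 1.
  rewrite (tv_near (lof_tan lE k) H) (tv_add (lof_tan lE k)) //; exact: second_form_smooth.
by rewrite !HE.
Qed.

Lemma grad_star_tau : grad (star_tau N) p =
  (dsecond_form N p E 0 0 1 - dsecond_form N p E 0 1 0) *: E 0 p +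
  (dsecond_form N p E 1 0 1 - dsecond_form N p E 1 1 0) *: E 1 p.
Proof.
rewrite (gradE hN (lof_on lE)) sum2.
have H : {near p, star_tau N =1 fun q => second_form N E 0 1 q + - second_form N E 1 0 q}.
  apply: filterS2 (lof_near lE) pE => q lEq pEq.
  by apply: (star_tauE hN) => //; exact: bracket_tangent.
have HE k : E k p (star_tau N) = dsecond_form N p E k 0 1 - dsecond_form N p E k 1 0.
  rewrite (tv_near (lof_tan lE k) H) (tv_add (lof_tan lE k)).
  - by rewrite (tv_opp (lof_tan lE k)) //; exact: second_form_smooth.
  - exact: second_form_smooth.
  - by apply: smoothN; exact: second_form_smooth.
by rewrite !HE.
Qed.

(** The parameter k covers both connections: it is 0 for the projected one and 1
    for the Levi-Civita one, by [levi_civita_trace].  Writing second derivatives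
    of n by means of derivatives of W, and exchanging the mixed ones by
    [codazzi], leaves a polynomial identity in each component. *)
Lemma oriented_laplacian (nabla : connection M) (k : R) :
  (forall i, is_tangent p (nabla p (E i p) (E i))) ->
  (forall l, \sum_i dot (sc p (nabla p (E i p) (E i))) (sc p (E l p)) =
    \sum_i cconn p E i i l - k * dot (sc p (sharp p (tr_torsion D p))) (sc p (E l p))) ->
  - phi_inv g p (laplacian g DS nabla E p) =
  grad (mean_curv D N) p + Jrot p (grad (star_tau N) p) +
  (mean_curv D N p *: sharp p (tr_torsion D p) +
   star_tau N p *: Jrot p (sharp p (tr_torsion D p)) -
   (1 - k) *: weingarten D N p (sharp p (tr_torsion D p))).
Proof.
move=> tn nE; have oE := lof_on lE; have tE := lof_tan lE.
pose G i l := dot (sc p (nabla p (E i p) (E i))) (sc p (E l p)).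
have [tL LE] := laplacian_comp hN lE hg hnS hDS tn (fun i l => erefl (G i l)).
rewrite (phi_invE hN lE hg tL) !sum2 !LE !sum2.
rewrite grad_mean_curv grad_star_tau (mean_curvE hN hD lE).
rewrite (star_tauE hN bracket_tangent lE (nbhs_singleton pE)).
rewrite (sharp_torsionE hN hD bracket_tangent lE) in nE *.
have uE : ctorsion p E 1 *: E 0 p - ctorsion p E 0 *: E 1 p =
  ctorsion p E 1 *: E 0 p + (- ctorsion p E 0) *: E 1 p by rewrite scaleNr.
rewrite uE in nE *.
have tu : is_tangent p (ctorsion p E 1 *: E 0 p + - ctorsion p E 0 *: E 1 p).
  by apply: tangentD; exact: tangentZ.
pose f (i : 'I_2) := [:: ctorsion p E 1; - ctorsion p E 0]`_i.
have fE : ctorsion p E 1 *: E 0 p + - ctorsion p E 0 *: E 1 p = \sum_i f i *: E i p.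
  by rewrite sum2.
rewrite !oriented_Jrot (weingartenE hN hD lE tu) sum2 fE vderiv_comb !sum2 !dotDl !dotZl.
have n0 := nE 0; have n1 := nE 1; move: n0 n1.
rewrite fE (scoord_comb oE) !(dot_comb oE f) !sum2 -!/(G _ _).
rewrite /f /= => n0 n1.
have z k' i : cconn p E k' i i = 0 by have := cconn_anti lE k' i i; lra.
have c0 := codazzi hN bracket_tangent lE 0; have c1 := codazzi hN bracket_tangent lE 1.
rewrite !sum2 in c0 c1.
have d k' i j := dsecond_formE hN lE k' i j.
rewrite !d !sum2 !z !(cconn_anti lE _ 1 0).
rewrite !z !(cconn_anti lE _ 1 0) in n0 n1 c0 c1.
have dn i j : dot (vderiv (E i p) (ncoord N)) (sc p (E j p)) = - second_form N E i j p.
  by rewrite opprK.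
rewrite !dn; move: n0 n1 c0 c1.
move: (G 0 0) (G 0 1) (G 1 0) (G 1 1) => G00 G01 G10 G11.
move: (cconn p E 0 0 1) (cconn p E 1 0 1) (ctorsion p E 0) (ctorsion p E 1) => g0 g1 t0 t1.
move: (second_form N E 0 0 p) (second_form N E 0 1 p) (second_form N E 1 0 p)
  (second_form N E 1 1 p) => w00 w01 w10 w11.
move: (dot (hess N p E 0 0) _) (dot (hess N p E 0 0) _) (dot (hess N p E 1 1) _)
  (dot (hess N p E 1 1) _) (dot (hess N p E 1 0) _) (dot (hess N p E 1 0) _).
move: (dot (hess N p E 0 1) _) (dot (hess N p E 0 1) _).
move=> h1 h2 h3 h4 h5 h6 h7 h8.
move: (E 0 p) (E 1 p) => x y n0 n1 c0 c1.
have -> : G10 = - G00 + (0 - g1 - k * t1) by rewrite -n0 addKr.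
have -> : G11 = - G01 + (g0 + 0 - k * - t0) by rewrite -n1 addKr.
move/eqP: c0; rewrite subr_eq => /eqP ->; move/eqP: c1; rewrite subr_eq => /eqP ->.
apply/funext => h; rewrite !(tv_addE, tv_oppE, tv_scaleE); ring.
Qed.

Lemma phi_inv_eq0 w : is_tangent (g p) w -> phi_inv g p w = 0 -> w = 0.
Proof.
move=> tw; rewrite (phi_invE hN lE hg tw) => w0; apply: (ucoord_eq0 tw).
have oE := lof_on lE.
apply: (perp_eq0 hN oE); first by rewrite -[ncoord N p]hg dot_upt_ucoord.
move=> j; have := dot_comb oE (fun j => dot (ucoord w) (sc p (E j p))) j.
by rewrite -(scoord_comb oE) w0 scoord0 dot0l.
Qed.

Lemma oriented_main :
  [/\ - phi_inv g p (laplacian g DS (projected_conn D) E p) =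
       grad (mean_curv D N) p + Jrot p (grad (star_tau N) p) +
       (mean_curv D N p *: sharp p (tr_torsion D p) +
        star_tau N p *: Jrot p (sharp p (tr_torsion D p)) -
        weingarten D N p (sharp p (tr_torsion D p))),
     - phi_inv g p (laplacian g DS nbar E p) =
       grad (mean_curv D N) p + Jrot p (grad (star_tau N) p) +
       (mean_curv D N p *: sharp p (tr_torsion D p) +
        star_tau N p *: Jrot p (sharp p (tr_torsion D p)))
   & (forall q, mean_curv D N q = 0) -> (forall q, star_tau N q = 0) ->
     laplacian g DS nbar E p = 0].
Proof.
have tE := lof_tan lE; have sE := lof_field lE.
have [tn nE] := levi_civita_trace hN hD bracket_tangent lE hnbar.
have L2 : - phi_inv g p (laplacian g DS nbar E p) =
       grad (mean_curv D N) p + Jrot p (grad (star_tau N) p) +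
       (mean_curv D N p *: sharp p (tr_torsion D p) +
        star_tau N p *: Jrot p (sharp p (tr_torsion D p))).
  rewrite (oriented_laplacian (k := 1) tn) => [|l]; last by rewrite mul1r nE.
  by rewrite subrr scale0r subr0.
split=> //.
  rewrite (oriented_laplacian (k := 0)) => [|i|l].
  - by rewrite subr0 scale1r.
  - by apply: (projected_tangent hN hD lE).
  - rewrite mul0r subr0; apply: eq_bigr => i _.
    exact: (projected_cconn hN hD lE).
move=> H0 st0; apply: phi_inv_eq0.
  by have [] := laplacian_comp hN lE hg hnS hDS tn (fun i l => erefl).
have gradE0 f : (forall q, f q = 0) -> grad f p = 0.
  move=> f0; have -> : f = fun=> 0 by apply/funext.
  rewrite (gradE hN (lof_on lE)) big1 // => i _.
  by rewrite (tv_cst 0 (tE i)) scale0r.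
apply/eqP; rewrite -oppr_eq0 L2 H0 st0 !scale0r !gradE0 //.
have := oriented_Jrot 0 0; rewrite !scale0r addr0 subr0 => ->.
by rewrite !addr0.
Qed.

End Oriented.

Lemma frame_det_smooth (R : realType) (Mt : weitzenbock R) (M : oriented_surface Mt)
    (N : M -> tvec Mt) (hN : is_unit_normal N) (p : M) (E : 'I_2 -> M -> tvec M) :
  local_orthonormal_frame p E -> smooth_at p (fun q => \det (frame_mx N q (fun i => E i q))).
Proof.
move=> lE; apply: smooth_det => i j; rewrite /frame_mx.
case: (split_ordP i) => k ->.
  apply: (smooth_ext _ (ncoord_smooth hN p j)).
  by apply: nearW => q; rewrite col_mxEu ord1.
apply: (smooth_ext _ (scoord_smooth j (lof_field lE k))).
by apply: nearW => q; rewrite col_mxEd mxE.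
Qed.

(** Orientation matters for J and for the Hodge dual but not for the Laplacian,
    so that a negatively oriented frame may be exchanged for its swap. *)
Definition swap_frame (R : realType) (n : nat) (M : manifold R n)
  (E : 'I_2 -> M -> tvec M) (i : 'I_2) : M -> tvec M := if i == 0 then E 1 else E 0.

Lemma swap_frame_lof (R : realType) (Mt : weitzenbock R) (M : oriented_surface Mt)
    (p : M) (E : 'I_2 -> M -> tvec M) :
  local_orthonormal_frame p E -> local_orthonormal_frame p (swap_frame E).
Proof.
move=> [sE oE]; split=> [i|]; first by rewrite /swap_frame; case: ifP.
apply: filterS oE => q [tq oq]; split=> [i|i j]; rewrite /swap_frame.
  by case: ifP.
by have [->|->] := ord2P i; have [->|->] := ord2P j; rewrite oq.
Qed.

(** The determinant of an orthonormal frame is a continuous function with values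
    1 and -1. *)
Lemma oriented_or_swap (R : realType) (Mt : weitzenbock R) (M : oriented_surface Mt)
    (N : M -> tvec Mt) (hN : is_unit_normal N) (p : M) (E : 'I_2 -> M -> tvec M) :
  local_orthonormal_frame p E ->
  (\forall q \near p, spos q (fun i => E i q)) \/
  (\forall q \near p, spos q (fun i => swap_frame E i q)).
Proof.
move=> lE; pose d q := \det (frame_mx N q (fun i => E i q)).
have cd : {for p, continuous d} := smooth_cont (frame_det_smooth hN lE).
have d0 : d p != 0.
  have := det_frame_mx hN (lof_on lE); rewrite -/(d p); case: eqP => // ->.
  by rewrite expr0n => /eqP; rewrite eq_sym oner_eq0.
have [dp|dp] : 0 < d p \/ d p < 0 by move: d0; rewrite neq_lt => /orP[]; [right|left].
- left; have nd : \forall q \near p, 0 < d q := cd _ (open_near (@open_gt _ 0) dp).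
  apply: filterS2 nd (lof_near lE) => q dq lq.
  by apply/(spos_det hN); first exact: lof_tan lq.
- right; have nd : \forall q \near p, d q < 0 := cd _ (open_near (@open_lt _ 0) dp).
  apply: filterS2 nd (lof_near lE) => q dq lq.
  apply/(spos_det hN); first exact: lof_tan (swap_frame_lof lq).
  pose A : 'M[R]_2 := \matrix_(i, j) (i != j)%:R.
  rewrite (frame_mx_comb N (A := A) (lof_on lq)).
    by rewrite det_mx2 !mxE /= mul0r sub0r mulr1 mulN1r oppr_gt0.
  move=> i; rewrite sum2 !mxE /swap_frame.
  by have [->|->] := ord2P i; rewrite /= scale0r scale1r ?add0r ?addr0.
Qed.

Lemma laplacian_swap (R : realType) (Mt : weitzenbock R) (M : oriented_surface Mt)
    (S2 : unit_sphere R) (g : M -> S2) DS nabla (E : 'I_2 -> M -> tvec M) p :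
  laplacian g DS nabla (swap_frame E) p = laplacian g DS nabla E p.
Proof. by rewrite /laplacian !sum2 addrC. Qed.

Theorem theorem2 (R : realType) (Mt : weitzenbock R) (M : oriented_surface Mt)
    (N : M -> tvec Mt) (hN : is_unit_normal N)
    (D : M -> tvec M -> (M -> tvec Mt) -> tvec Mt)
    (hD : is_pullback (wconn (w := Mt)) (sincl (o := M)) D)
    (nbar : connection M) (hnbar : is_levi_civita (smetric (M := M)) nbar)
    (S2 : unit_sphere R) (g : M -> S2) (hg : is_gauss_map N g)
    (nS : connection S2) (hnS : is_levi_civita (round_metric (S2 := S2)) nS)
    (DS : M -> tvec M -> (M -> tvec S2) -> tvec S2)
    (hDS : is_pullback nS g DS) :
  let W := weingarten D N in
  let H := mean_curv D N in
  let st := star_tau N in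
  let J := Jrot (M := M) in
  let trT := fun p => sharp p (tr_torsion D p) in
  (forall (p : M) (E : 'I_2 -> M -> tvec M), local_orthonormal_frame p E ->
     - phi_inv g p (laplacian g DS (projected_conn D) E p) =
       grad H p + J p (grad st p)
       + (H p *: trT p + st p *: J p (trT p) - W p (trT p))
     /\
     - phi_inv g p (laplacian g DS nbar E p) =
       grad H p + J p (grad st p) + (H p *: trT p + st p *: J p (trT p)))
  /\
  ((forall p, (H p +i* st p)%C = 0) ->
     forall (p : M) (E : 'I_2 -> M -> tvec M), local_orthonormal_frame p E ->
       laplacian g DS nbar E p = 0).
Proof.
move=> W H st J trT.
have main p E : local_orthonormal_frame p E -> (\forall q \near p, spos q (fun i => E i q)) -> _ :=
  fun lE pE => oriented_main hN hD hnbar hg hnS hDS lE pE.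
split=> [p E lE|Hst p E lE].
  have [pE|pE] := oriented_or_swap hN lE; first by have [] := main p E lE pE.
  have [] := main p _ (swap_frame_lof lE) pE.
  by rewrite !laplacian_swap.
have H0 q : mean_curv D N q = 0 by have /(congr1 (@complex.Re R)) := Hst q.
have st0 q : star_tau N q = 0 by have /(congr1 (@complex.Im R)) := Hst q.
have [pE|pE] := oriented_or_swap hN lE; first by have [_ _] := main p E lE pE; apply.
have [_ _] := main p _ (swap_frame_lof lE) pE.
by rewrite laplacian_swap; apply.
Qed.
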